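(* Let $n\ge1$ and let $\delta>0$ be fixed. Let $\mathbf f\in\mathcal H^{s_1}(\mathbf T^n)$ and $\mathbf g\in\mathcal H^{s_2}(\mathbf T^n)$ with $s_1,s_2\in\mathbb{R}$. For $\beta<n+2$ and $t\ge0$ let $\mathbf U^{\delta,\beta}(t)\in\mathcal H^{s'}(\mathbf T^n)$, $s'=\min\{s_1,s_2+\max\{0,\frac{\beta-n}{2}\}\}$, be the solution of the peridynamic equation $\frac{d^2}{dt^2}\mathbf U=\mathcal L^{\delta,\beta}\mathbf U$, $\mathbf U(0)=\mathbf f$, $\frac{d}{dt}\mathbf U(0)=\mathbf g$, and let $\mathbf U^{\mathcal N}(t)\in\mathcal H^{s}(\mathbf T^n)$, $s=\min\{s_1,s_2+1\}$, be the solution of the Navier–Cauchy equation $\frac{d^2}{dt^2}\mathbf U^{\mathcal N}=\mathcal N\mathbf U^{\mathcal N}$, $\mathbf U^{\mathcal N}(0)=\mathbf f$, $\frac{d}{dt}\mathbf U^{\mathcal N}(0)=\mathbf g$. Then for each $t\ge0$ and each $0<\epsilon<2$, $$\lim_{\beta\to (n+2)^-}\mathbf U^{\delta,\beta}(t)=\mathbf U^{\mathcal N}(t)\quad\text{in }\mathcal H^{s_0}(\mathbf T^n),\qquad s_0=\min\left\{s_1,s_2+\tfrac{2-\epsilon}{2}\right\}.$$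
   Context: Torus and spaces: $\mathbf T^n=\prod_{i=1}^n[0,2\pi]$ with periodic identification; a periodic vector distribution $\mathbf g$ is written $\mathbf g=\sum_{k\in\mathbb{Z}^n}\widehat{\mathbf g}_k e^{ik\cdot x}$ with $\widehat{\mathbf g}_k\in\mathbb{C}^n$. For $q\in\mathbb{R}$, $\mathcal H^q(\mathbf T^n)$ is the space of periodic vector distributions with $\|\mathbf g\|^2_{\mathcal H^q}=\sum_k(1+\|k\|^2)^q\|\widehat{\mathbf g}_k\|^2<\infty$. Multipliers: with ${}_pF_q(a_1,\dots,a_p;b_1,\dots,b_q;x)=\sum_{m\ge0}\frac{(a_1)_m\cdots(a_p)_m}{(b_1)_m\cdots(b_q)_m}\frac{x^m}{m!}$, where $(a)_m=a(a+1)\cdots(a+m-1)$, set for $\nu\in\mathbb{R}^n$ $$\lambda_1(\nu)=-\|\nu\|^2\Big(3\mu\,{}_3F_4\big(1,\tfrac52,\tfrac{n+2-\beta}{2};2,\tfrac32,\tfrac{n+4}{2},\tfrac{n+4-\beta}{2};-\tfrac14\|\nu\|^2\delta^2\big)+(\lambda^*-\mu)\,{}_1F_2\big(\tfrac{n+2-\beta}{2};\tfrac{n+2}{2},\tfrac{n+4-\beta}{2};-\tfrac14\|\nu\|^2\delta^2\big)^2\Big),$$ $$\lambda_2(\nu)=-\mu\|\nu\|^2\,{}_2F_3\big(1,\tfrac{n+2-\beta}{2};2,\tfrac{n+4}{2},\tfrac{n+4-\beta}{2};-\tfrac14\|\nu\|^2\delta^2\big).$$ $M_k$ ($k\in\mathbb{Z}^n$)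 is the real symmetric $n\times n$ matrix with $M_kk=\lambda_1(k)k$, $M_kw=\lambda_2(k)w$ for $w\perp k$, and $M_0=0$; $M^{\mathcal N}_k=-(\lambda^*+\mu)k\otimes k-\mu\|k\|^2I$. The peridynamic and Navier operators act by $\mathcal L^{\delta,\beta}\mathbf u=\sum_kM_k\widehat{\mathbf u}_ke^{ik\cdot x}$ and $\mathcal N\mathbf u=\sum_kM_k^{\mathcal N}\widehat{\mathbf u}_ke^{ik\cdot x}$ (i.e. $\mathcal N\mathbf u=(\lambda^*+\mu)\nabla(\nabla\cdot\mathbf u)+\mu\Delta\mathbf u$). Solutions: the solutions are given explicitly by $$\mathbf U^{\delta,\beta}(t)=(\widehat{\mathbf f}_0+\widehat{\mathbf g}_0t)+\sum_{0\ne k\in\mathbb{Z}^n}\left(\cos(\sqrt{-M_k}\,t)\widehat{\mathbf f}_k+\sin(\sqrt{-M_k}\,t)(\sqrt{-M_k})^{-1}\widehat{\mathbf g}_k\right)e^{ik\cdot x},$$ and $\mathbf U^{\mathcal N}(t)$ by the same formula with $M_k$ replaced by $M_k^{\mathcal N}$; functions of symmetric matrices are defined by functional calculus on eigenvalues. Standing assumption: the Lamé parameters satisfy $\mu>0$, $\lambda^*+2\mu>0$ (so $-M_k^{\mathcal N}$ is positive definite for $k\ne0$), and are such that $\lambda_1(\nu)<0$ for all $\nu\ne0$ and all parameter values under consideration (and $\lambda_2(\nu)<0$ for all $\nu\ne0$). *)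

(* Defs.v *)
From HB Require Import structures.
From mathcomp Require Import all_boot all_order all_algebra.
From mathcomp Require Import all_classical all_reals all_analysis.
From mathcomp Require Import complex ring.

Set Implicit Arguments.
Unset Strict Implicit.
Unset Printing Implicit Defensive.

Import Order.TTheory GRing.Theory Num.Theory.
Import numFieldNormedType.Exports.

Local Open Scope classical_set_scope.
Local Open Scope ring_scope.
Local Open Scope complex_scope.

Section Multipliers.
Context {R : realType}.

Definition pochhammer (a : R) (m : nat) : R := \prod_(i < m) (a + i%:R).

(* pFq(a; b; x), where the lists a and b hold the p upper and q lower
   parameters. *)
Definition hypergeom (a b : seq R) (x : R) : R :=
  limn (series (fun m : nat =>
    (\prod_(c <- a) pochhammer c m) / (\prod_(c <- b) pochhammer c m)
      * (x ^+ m / (m`!)%:R))).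

(* The Euclidean norm squared; the norm `|v| that the library puts on matrices
   is the sup norm. *)
Definition sqnorm n (v : 'cV[R]_n) : R := \sum_i v i 0 ^+ 2.

Definition lambda1 n (delta lam mu beta : R) (nu : 'cV[R]_n) : R :=
  let N := n%:R in
  let x := - (4^-1 * sqnorm nu * delta ^+ 2) in
  - sqnorm nu *
    (3 * mu * hypergeom [:: 1; 5 / 2; (N + 2 - beta) / 2]
                [:: 2; 3 / 2; (N + 4) / 2; (N + 4 - beta) / 2] x
     + (lam - mu) * hypergeom [:: (N + 2 - beta) / 2]
                      [:: (N + 2) / 2; (N + 4 - beta) / 2] x ^+ 2).

Definition lambda2 n (delta mu beta : R) (nu : 'cV[R]_n) : R :=
  let N := n%:R in
  let x := - (4^-1 * sqnorm nu * delta ^+ 2) in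
  - mu * sqnorm nu *
    hypergeom [:: 1; (N + 2 - beta) / 2]
      [:: 2; (N + 4) / 2; (N + 4 - beta) / 2] x.

(* The symmetric matrix with eigenvalue lambda1 on the line of nu and lambda2
   on its orthogonal complement, see perimx_nu, perimx_ortho and perimx_uniq. At
   nu = 0 it vanishes, see perimx0. *)
Definition perimx n (delta lam mu beta : R) (nu : 'cV[R]_n) : 'M[R]_n :=
  let l1 := lambda1 delta lam mu beta nu in
  let l2 := lambda2 delta mu beta nu in
  l2%:M + ((l1 - l2) / sqnorm nu) *: (nu *m nu^T).

Definition naviermx n (lam mu : R) (nu : 'cV[R]_n) : 'M[R]_n :=
  - ((lam + mu) *: (nu *m nu^T)) - (mu * sqnorm nu)%:M.

Definition orthodiag n (P : 'M[R]_n) (d : 'rV[R]_n) (A : 'M[R]_n) : Prop :=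
  P^T *m P = 1%:M /\ A = P^T *m diag_mx d *m P.

(* Functional calculus for real symmetric matrices: f is applied to the
   eigenvalues in an orthogonal diagonalization. By mxfun_orthodiag the value
   does not depend on the diagonalization. *)
Definition mxfun n (f : R -> R) (A : 'M[R]_n) : 'M[R]_n :=
  xget 0 [set B | exists P d,
    orthodiag P d A /\ B = P^T *m diag_mx (map_mx f d) *m P].

Definition sqrtmx n (A : 'M[R]_n) : 'M[R]_n := mxfun Num.sqrt A.
Definition cosmx n (A : 'M[R]_n) : 'M[R]_n := mxfun (@cos R) A.
Definition sinmx n (A : 'M[R]_n) : 'M[R]_n := mxfun (@sin R) A.

End Multipliers.

Section PeriodicDistributions.
Context {R : realType} {n : nat}.

(* A periodic vector distribution is given by its Fourier coefficients. *)
Definition pdist := 'cV[int]_n -> 'cV[R[i]]_n.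

Definition freq (k : 'cV[int]_n) : 'cV[R]_n := map_mx intr k.

Definition csqnorm (z : 'cV[R[i]]_n) : R :=
  \sum_i (complex.Re (z i 0) ^+ 2 + complex.Im (z i 0) ^+ 2).

Definition sobolev_sqnorm (q : R) (g : pdist) : \bar R :=
  \esum_(k in [set: 'cV[int]_n])
    (((1 + sqnorm (freq k)) `^ q * csqnorm (g k))%:E).

Definition sobolev_norm (q : R) (g : pdist) : \bar R :=
  sqrte (sobolev_sqnorm q g).

(* A finite q-norm forces polynomial growth of the coefficients, so every
   member is the coefficient family of a distribution. *)
Definition sobolev (q : R) : set pdist :=
  [set g | (sobolev_sqnorm q g < +oo)%E].

Definition sobolev_cvg (q : R) (F : set_system R) (U : R -> pdist)
    (V : pdist) : Prop :=
  [/\ \forall b \near F, sobolev q (U b), sobolev q V &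
      sobolev_norm q (U b \- V) @[b --> F] --> 0%E].

Definition cmx m p (A : 'M[R]_(m, p)) : 'M[R[i]]_(m, p) :=
  map_mx (real_complex R) A.

(* Solution at time t of U'' = M U, U(0) = f, U'(0) = g, where M is the Fourier
   multiplier with matrices M k, see wave_solution_ivp,
   peridynamic_solution_ivp and navier_solution_ivp. *)
Definition wave_solution (M : 'cV[int]_n -> 'M[R]_n) (f g : pdist) (t : R) :
    pdist := fun k =>
  if k == 0 then f 0 + t%:C *: g 0
  else let S := sqrtmx (- M k) in
    cmx (cosmx (t *: S)) *m f k + cmx (sinmx (t *: S) *m invmx S) *m g k.

Definition peridynamic_solution (delta lam mu beta : R) : pdist -> pdist ->
    R -> pdist :=
  wave_solution (fun k => perimx delta lam mu beta (freq k)).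

Definition navier_solution (lam mu : R) : pdist -> pdist -> R -> pdist :=
  wave_solution (fun k => naviermx lam mu (freq k)).

Definition cderive (z : R -> 'cV[R[i]]_n) (t : R) (w : 'cV[R[i]]_n) : Prop :=
  forall i, is_derive t 1 (fun s => complex.Re (z s i 0)) (complex.Re (w i 0)) /\
            is_derive t 1 (fun s => complex.Im (z s i 0)) (complex.Im (w i 0)).

(* U'' = M U, U(0) = f, U'(0) = g in the sense of Fourier coefficients. *)
Definition wave_ivp (M : 'cV[int]_n -> 'M[R]_n) (f g : pdist)
    (U : R -> pdist) : Prop :=
  exists V : R -> pdist,
    [/\ U 0 = f, V 0 = g,
        forall t k, cderive (U ^~ k) t (V t k) &
        forall t k, cderive (V ^~ k) t (cmx (M k) *m U t k)].

End PeriodicDistributions.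
Arguments pdist : clear implicits.

Section FunctionalCalculus.
Context {R : realType}.
Implicit Types (n : nat) (a b : R).

Lemma mxfun_orthodiag n (f : R -> R) (P A : 'M[R]_n) (d : 'rV[R]_n) :
  orthodiag P d A -> mxfun f A = P^T *m diag_mx (map_mx f d) *m P.
Proof.
move=> [PP AP]; apply: xget_unique; first by exists P, d.
move=> _ [Q [e [[QQ AQ] ->]]].
have PP' := mulmx1C PP; have QQ' := mulmx1C QQ.
pose W := P *m Q^T.
have WE : diag_mx d *m W = W *m diag_mx e.
  have : P *m A *m Q^T = P *m A *m Q^T by [].
  by rewrite {1}AP AQ /W !mulmxA PP' mul1mx -!mulmxA QQ' mulmx1.
have WfE : diag_mx (map_mx f d) *m W = W *m diag_mx (map_mx f e).
  apply/matrixP => i j; move/matrixP/(_ i j): WE.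
  rewrite !mul_diag_mx !mul_mx_diag !mxE.
  have [->|W0] := eqVneq (\sum_j0 P i j0 * Q^T j0 j) 0; first by rewrite !mulr0 !mul0r.
  by rewrite [RHS]mulrC => /(mulIf W0) ->; rewrite mulrC.
have -> : Q^T = P^T *m W by rewrite /W mulmxA PP mul1mx.
have -> : Q = W^T *m P by rewrite /W trmx_mul trmxK -mulmxA PP mulmx1.
have WW : W *m W^T = 1%:M.
  by rewrite /W trmx_mul trmxK -mulmxA (mulmxA Q^T) QQ mul1mx.
have -> : P^T *m W *m diag_mx (map_mx f e) = P^T *m diag_mx (map_mx f d) *m W.
  by rewrite -mulmxA -WfE mulmxA.
by rewrite -mulmxA (mulmxA W) WW mul1mx.
Qed.

Lemma sqnorm_mx n (v : 'cV[R]_n) : v^T *m v = (sqnorm v)%:M.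
Proof.
apply/matrixP => i j; rewrite !ord1 !mxE eqxx mulr1n.
by apply: eq_bigr => k _; rewrite !mxE expr2.
Qed.

Lemma sqnorm_eq0 n (v : 'cV[R]_n) : (sqnorm v == 0) = (v == 0).
Proof.
rewrite psumr_eq0 => [|i _]; last exact: sqr_ge0.
apply/allP/eqP => [v0|-> i _]; last by rewrite mxE expr0n eqxx.
apply/colP => i; rewrite mxE; apply/eqP.
by rewrite -sqrf_eq0; exact: (v0 i (mem_index_enum i)).
Qed.

Lemma sqnorm_ge0 n (v : 'cV[R]_n) : 0 <= sqnorm v.
Proof. by apply: sumr_ge0 => i _; exact: sqr_ge0. Qed.

Lemma reflection n (u e : 'cV[R]_n) : sqnorm u = 1 -> sqnorm e = 1 ->
  exists P : 'M[R]_n, P^T *m P = 1%:M /\ P *m u = e.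
Proof.
move=> u1 e1; have [->|w0] := eqVneq u e.
  by exists 1%:M; rewrite trmx1 !mul1mx.
pose w := u - e; pose N := sqnorm w; pose c := 2 / N.
have N0 : N != 0 by rewrite sqnorm_eq0 subr_eq0.
have uu : u^T *m u = 1%:M by rewrite sqnorm_mx u1.
have ee : e^T *m e = 1%:M by rewrite sqnorm_mx e1.
have eu : e^T *m u = u^T *m e.
  by rewrite -[LHS]trmxK trmx_mul trmxK [u^T *m e]mx11_scalar tr_scalar_mx.
have wT : w^T = u^T - e^T by rewrite /w linearB.
have wu : w^T *m u = (N / 2)%:M.
  have: w^T *m w = 2 *: (w^T *m u).
    rewrite wT /w mulmxBr !mulmxBl uu ee eu scaler_nat mulr2n.
    by rewrite opprB.
  rewrite sqnorm_mx -/N => NE; apply: (@scalerI R _ 2); first by rewrite pnatr_eq0.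
  by rewrite -NE scale_scalar_mx; congr _%:M; field.
exists (1%:M - c *: (w *m w^T)).
have PT : (1%:M - c *: (w *m w^T))^T = 1%:M - c *: (w *m w^T).
  by rewrite linearB linearZ /= trmx1 trmx_mul trmxK.
split.
  rewrite PT mulmxBl mul1mx mulmxBr mulmx1 -scalemxAl -scalemxAr.
  rewrite mulmxA -(mulmxA w) sqnorm_mx -/N mul_mx_scalar -scalemxAl !scalerA.
  have -> : c * (c * N) = c + c by rewrite /c; field.
  by rewrite scalerDl opprB addrK subrK.
rewrite mulmxBl mul1mx -scalemxAl -mulmxA wu mul_mx_scalar scalerA.
have -> : c * (N / 2) = 1 by rewrite /c; field.
by rewrite scale1r /w subKr.
Qed.

Lemma rank1_orthodiag n (v : 'cV[R]_n) a b : v != 0 ->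
  exists P d, orthodiag P d (a%:M + (b / sqnorm v) *: (v *m v^T)) /\
    forall j, d 0 j = a \/ d 0 j = a + b.
Proof.
case: n v => [|n] v v0; first by rewrite [v]flatmx0 eqxx in v0.
have N0 : 0 < sqnorm v by rewrite lt_def sqnorm_eq0 v0 sqnorm_ge0.
pose s := Num.sqrt (sqnorm v).
have s0 : s != 0 by rewrite sqrtr_eq0 -ltNge.
have ss : s ^+ 2 = sqnorm v by rewrite sqr_sqrtr // ltW.
pose e : 'cV[R]_n.+1 := delta_mx 0 0.
have [||P [PP Pu]] := @reflection _ (s^-1 *: v) e.
- rewrite /sqnorm; under eq_bigr do rewrite mxE exprMn.
  by rewrite -mulr_sumr -/(sqnorm v) -ss exprVn mulVf // sqrf_eq0.
- rewrite /sqnorm (bigD1 0) //= big1 => [|i i0].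
    by rewrite mxE !eqxx expr1n addr0.
  by rewrite mxE (negbTE i0) expr0n.
have Pe : P^T *m e = s^-1 *: v by rewrite -Pu mulmxA PP mul1mx.
exists P, (\row_j (a + b *+ (j == 0))); split; last first.
  by move=> j; rewrite mxE; case: eqP => _; [right|left; rewrite addr0].
split=> //.
have -> : diag_mx (\row_j (a + b *+ (j == 0))) = a%:M + b *: (e *m e^T).
  apply/matrixP => i j; rewrite !mxE big_ord1 !mxE.
  case: (eqVneq i j) => [->|ij]; rewrite ?mulr1n ?mulr0n ?add0r.
    by case: eqP => _; rewrite ?mulr1 ?mulr0 ?mulr1n.
  case: (eqVneq i 0) => [i0|]; last by rewrite mul0r mulr0.
  case: (eqVneq j 0) => [j0|]; last by rewrite !mulr0.
  by rewrite i0 j0 eqxx in ij.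
rewrite mulmxDr mulmxDl mul_mx_scalar -scalemxAl PP scalemx1; congr (_ + _).
rewrite -scalemxAr -scalemxAl mulmxA Pe -mulmxA.
have -> : e^T *m P = (P^T *m e)^T by rewrite trmx_mul trmxK.
rewrite Pe linearZ /= -scalemxAl -scalemxAr !scalerA.
by congr (_ *: _); rewrite -ss; field.
Qed.

End FunctionalCalculus.

Section MultiplierFacts.
Context {R : realType} (n : nat) (delta lam mu beta : R).
Implicit Types nu w : 'cV[R]_n.
Let l1 := @lambda1 R n delta lam mu beta.
Let l2 := @lambda2 R n delta mu beta.
Let M := @perimx R n delta lam mu beta.

Lemma perimx0 : M 0 = 0.
Proof.
have s0 : sqnorm (0 : 'cV[R]_n) = 0 by apply/eqP; rewrite sqnorm_eq0.
by rewrite /M /perimx mul0mx scaler0 addr0 /lambda2 s0 mulr0 mul0r raddf0.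
Qed.

Lemma perimx_sym nu : (M nu)^T = M nu.
Proof. by rewrite /M /perimx linearD linearZ /= tr_scalar_mx trmx_mul trmxK. Qed.

Lemma perimx_nu nu : M nu *m nu = l1 nu *: nu.
Proof.
have [->|nu0] := eqVneq nu 0; first by rewrite mulmx0 scaler0.
rewrite /M /perimx mulmxDl mul_scalar_mx -scalemxAl -mulmxA sqnorm_mx.
by rewrite mul_mx_scalar scalerA divfK ?sqnorm_eq0 // -scalerDl subrKC.
Qed.

Lemma perimx_ortho nu w : nu^T *m w = 0 -> M nu *m w = l2 nu *: w.
Proof.
move=> nuw; rewrite /M /perimx mulmxDl mul_scalar_mx -scalemxAl -mulmxA nuw.
by rewrite mulmx0 scaler0 addr0.
Qed.

Lemma perimx_uniq nu (A : 'M[R]_n) : nu != 0 -> A *m nu = l1 nu *: nu ->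
  (forall w, nu^T *m w = 0 -> A *m w = l2 nu *: w) -> A = M nu.
Proof.
move=> nu0 Anu Aw.
have H (x : 'cV[R]_n) : A *m x = M nu *m x.
  pose c := (nu^T *m x) 0 0 / sqnorm nu.
  have -> : x = c *: nu + (x - c *: nu) by rewrite subrKC.
  have ow : nu^T *m (x - c *: nu) = 0.
    rewrite mulmxBr -scalemxAr sqnorm_mx scale_scalar_mx divfK ?sqnorm_eq0 //.
    by rewrite -mx11_scalar subrr.
  move: (x - _) ow => w ow.
  by rewrite !mulmxDr (Aw w) // (perimx_ortho ow) -!scalemxAr Anu perimx_nu.
apply/matrixP => i j.
have /colP/(_ i) := H (delta_mx j 0).
by rewrite -!colE !mxE.
Qed.

End MultiplierFacts.

Section WaveSolutions.
Context {R : realType} {n : nat}.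
Implicit Types (t s : R) (P A : 'M[R]_n) (z : 'cV[R[i]]_n).

Lemma oscillator_uniq (w : R) (x y : R -> R) : 0 < w ->
  (forall t : R, is_derive t 1 x (y t)) ->
  (forall t : R, is_derive t 1 y (- (w ^+ 2 * x t))) ->
  forall t, x t = cos (t * w) * x 0 + sin (t * w) / w * y 0.
Proof.
move=> w0 xD yD t.
have cD (s : R) : is_derive s 1 (fun s => cos (s * w)) (- sin (s * w) * w).
  have : is_derive s 1 (fun s : R => s * w) w.
    by apply: is_derive_eq; rewrite scaler0 add0r [_%:A]mulr1.
  exact: is_derive1_comp.
have sD (s : R) : is_derive s 1 (fun s => sin (s * w)) (cos (s * w) * w).
  have : is_derive s 1 (fun s : R => s * w) w.
    by apply: is_derive_eq; rewrite scaler0 add0r [_%:A]mulr1.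
  exact: is_derive1_comp.
pose u s := w * (x s * cos (s * w)) - y s * sin (s * w).
pose v s := w * (x s * sin (s * w)) + y s * cos (s * w).
have uD (s : R) : is_derive s 1 u 0.
  apply: is_derive_eq; rewrite /GRing.scale /=; ring.
have vD (s : R) : is_derive s 1 v 0.
  apply: is_derive_eq; rewrite /GRing.scale /=; ring.
have := is_derive_0_is_cst 0 t uD; have := is_derive_0_is_cst 0 t vD.
rewrite /u /v mul0r sin0 cos0 !mulr0 !mulr1 add0r subr0 => -> wx0.
apply: (mulfI (lt0r_neq0 w0)).
rewrite mulrDr mulrCA wx0 (mulrCA w) (mulrA w) [X in _ + X]mulrCA mulrC.
have : cos (t * w) ^+ 2 + sin (t * w) ^+ 2 = 1 by exact: cos2Dsin2.
move=> cs; have w1 : w != 0 := lt0r_neq0 w0.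
transitivity (w * x t * (cos (t * w) ^+ 2 + sin (t * w) ^+ 2)).
  by rewrite cs mulr1 mulrC.
by field.
Qed.

Definition rderive (x : R -> 'cV[R]_n) t (y : 'cV[R]_n) : Prop :=
  forall i, is_derive t 1 (fun s => x s i 0) (y i 0).

Lemma rderive_mul (A : 'M[R]_n) x t y :
  rderive x t y -> rderive (fun s => A *m x s) t (A *m y).
Proof.
move=> xD i; rewrite mxE.
rewrite (_ : (fun s => _) = \sum_j (fun s => A i j * x s j 0)); last first.
  by apply/funext => s; rewrite mxE fct_sumE.
by apply: is_derive_sum => j; apply: (@is_deriveZ R R R _ (A i j)); exact: xD.
Qed.

Lemma rderiveD x x' t y y' :
  rderive x t y -> rderive x' t y' -> rderive (fun s => x s + x' s) t (y + y').
Proof.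
move=> xD xD' i; rewrite mxE.
under eq_fun do rewrite mxE.
exact: is_deriveD (xD i) (xD' i).
Qed.

Definition conjdiag (P : 'M[R]_n) (d : 'I_n -> R) : 'M[R]_n :=
  P^T *m diag_mx (\row_j d j) *m P.

Lemma conjdiag_orthodiag P d A : orthodiag P d A -> A = conjdiag P (d 0).
Proof.
move=> [_ {1}->]; rewrite /conjdiag; congr (_ *m diag_mx _ *m _).
by apply/rowP => j; rewrite mxE.
Qed.

Lemma mul_conjdiag P d e : P^T *m P = 1%:M ->
  conjdiag P d *m conjdiag P e = conjdiag P (fun j => d j * e j).
Proof.
move=> /mulmx1C PP; rewrite /conjdiag !mulmxA -(mulmxA _ P P^T) PP mulmx1.
rewrite -(mulmxA P^T); congr (_ *m _ *m _).
rewrite mul_diag_mx; apply/matrixP => i j; rewrite !mxE.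
by case: eqVneq => [->|_]; rewrite ?mulr1n ?mulr0n ?mulr0.
Qed.

Lemma mxfun_conjdiag P d (f : R -> R) : P^T *m P = 1%:M ->
  mxfun f (conjdiag P d) = conjdiag P (fun j => f (d j)).
Proof.
move=> PP; rewrite (@mxfun_orthodiag _ _ _ P _ (\row_j d j)) //.
by congr (_ *m diag_mx _ *m _); apply/rowP => j; rewrite !mxE.
Qed.

Lemma scale_conjdiag a P d : a *: conjdiag P d = conjdiag P (fun j => a * d j).
Proof.
rewrite /conjdiag scalemxAl scalemxAr -linearZ /=; congr (_ *m diag_mx _ *m _).
by apply/rowP => j; rewrite !mxE.
Qed.

Lemma invmx_conjdiag P d : P^T *m P = 1%:M -> (forall j, d j != 0) ->
  invmx (conjdiag P d) = conjdiag P (fun j => (d j)^-1).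
Proof.
move=> PP d0.
have D1 : conjdiag P d *m conjdiag P (fun j => (d j)^-1) = 1%:M.
  rewrite mul_conjdiag // /conjdiag.
  rewrite (_ : diag_mx _ = 1%:M) ?mulmx1 //; apply/matrixP => i j.
  by rewrite !mxE divff.
have [Du _] := mulmx1_unit D1.
by rewrite -[RHS](mulKmx Du) D1 mulmx1.
Qed.

Lemma conjdiag_mul P d (x : 'cV[R]_n) :
  conjdiag P d *m x = P^T *m (\col_j (d j * (P *m x) j 0)).
Proof.
rewrite /conjdiag -!mulmxA; congr (_ *m _).
by apply/colP => j; rewrite mul_diag_mx !mxE.
Qed.

Lemma rderive_conjdiag P (d : R -> 'I_n -> R) (e : 'I_n -> R) (x : 'cV[R]_n) t :
  (forall j, is_derive t 1 (d ^~ j) (e j)) ->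
  rderive (fun s => conjdiag P (d s) *m x) t (conjdiag P e *m x).
Proof.
move=> dD; under eq_fun do rewrite conjdiag_mul.
rewrite conjdiag_mul; apply: rderive_mul => j; rewrite mxE.
under eq_fun do rewrite mxE mulrC.
by rewrite mulrC; apply: (@is_deriveZ R R R _ _); exact: dD.
Qed.

Lemma wave_uniq_real (P A : 'M[R]_n) d (x y : R -> 'cV[R]_n) t :
  orthodiag P d A -> (forall j, 0 < d 0 j) ->
  (forall s, rderive x s (y s)) -> (forall s, rderive y s (- A *m x s)) ->
  x t = conjdiag P (fun j => cos (t * Num.sqrt (d 0 j))) *m x 0 +
    conjdiag P (fun j => sin (t * Num.sqrt (d 0 j)) / Num.sqrt (d 0 j)) *m y 0.
Proof.
move=> PdA d0 xD yD; have [PP AE] := PdA.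
rewrite !conjdiag_mul -mulmxDr -[LHS]mul1mx -PP -mulmxA; congr (_ *m _).
apply/colP => j.
have w0 : 0 < Num.sqrt (d 0 j) by rewrite sqrtr_gt0.
have zD s : is_derive s 1 (fun s => (P *m x s) j 0) ((P *m y s) j 0).
  exact: (rderive_mul P (xD s)).
have wD s : is_derive s 1 (fun s => (P *m y s) j 0)
    (- (Num.sqrt (d 0 j) ^+ 2 * (P *m x s) j 0)).
  have -> : - (Num.sqrt (d 0 j) ^+ 2 * (P *m x s) j 0) =
      (P *m (- A *m x s)) j 0.
    rewrite sqr_sqrtr ?ltW // mulNmx mulmxN mxE AE !mulmxA (mulmx1C PP) mul1mx.
    by rewrite -mulmxA mul_diag_mx !mxE.
  exact: (rderive_mul P (yD s)).
by rewrite (oscillator_uniq w0 zD wD) !mxE.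
Qed.

Definition rpart (z : 'cV[R[i]]_n) := map_mx (@complex.Re R) z.
Definition ipart (z : 'cV[R[i]]_n) := map_mx (@complex.Im R) z.

Lemma rpart_mul (A : 'M[R]_n) z : rpart (cmx A *m z) = A *m rpart z.
Proof.
apply/colP => i; rewrite !mxE.
rewrite (big_morph (@complex.Re R) (id1 := 0) (op1 := +%R)) => [|[? ?] [? ?]|] //.
by apply: eq_bigr => j _; rewrite !mxE; case: (z j 0) => a b /=; rewrite mul0r subr0.
Qed.

Lemma ipart_mul (A : 'M[R]_n) z : ipart (cmx A *m z) = A *m ipart z.
Proof.
apply/colP => i; rewrite !mxE.
rewrite (big_morph (@complex.Im R) (id1 := 0) (op1 := +%R)) => [|[? ?] [? ?]|] //.
by apply: eq_bigr => j _; rewrite !mxE; case: (z j 0) => a b /=; rewrite mul0r addr0.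
Qed.

Lemma rpartD z w : rpart (z + w) = rpart z + rpart w.
Proof. by apply/colP => i; rewrite !mxE; case: (z i 0) (w i 0) => ? ? []. Qed.

Lemma ipartD z w : ipart (z + w) = ipart z + ipart w.
Proof. by apply/colP => i; rewrite !mxE; case: (z i 0) (w i 0) => ? ? []. Qed.

Lemma rpartZ t z : rpart (t%:C *: z) = t *: rpart z.
Proof.
by apply/colP => i; rewrite !mxE; case: (z i 0) => ? ? /=; rewrite mul0r subr0.
Qed.

Lemma ipartZ t z : ipart (t%:C *: z) = t *: ipart z.
Proof.
by apply/colP => i; rewrite !mxE; case: (z i 0) => ? ? /=; rewrite mul0r addr0.
Qed.

Lemma part_inj z w : rpart z = rpart w -> ipart z = ipart w -> z = w.
Proof.
move=> /colP rzw /colP izw; apply/colP => i.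
move: (rzw i) (izw i); rewrite !mxE.
by case: (z i 0) (w i 0) => ? ? [? ?] /= -> ->.
Qed.

Lemma cderiveP (z : R -> 'cV[R[i]]_n) t w : cderive z t w <->
  rderive (fun s => rpart (z s)) t (rpart w) /\
  rderive (fun s => ipart (z s)) t (ipart w).
Proof.
split=> [zw|[rw iw] i].
  split=> i; rewrite mxE; under eq_fun do rewrite mxE; by have [] := zw i.
have := rw i; have := iw i; rewrite !mxE.
by under eq_fun do rewrite mxE; under [in X in _ -> X]eq_fun do rewrite mxE.
Qed.

Lemma wave_solution_conjdiag (M : 'cV[int]_n -> 'M[R]_n) f g k P d t :
  k != 0 -> orthodiag P d (- M k) -> (forall j, 0 < d 0 j) ->
  wave_solution M f g t k =
    cmx (conjdiag P (fun j => cos (t * Num.sqrt (d 0 j)))) *m f k +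
    cmx (conjdiag P (fun j => sin (t * Num.sqrt (d 0 j)) / Num.sqrt (d 0 j)))
      *m g k.
Proof.
move=> k0 PdM d0; have [PP _] := PdM.
rewrite /wave_solution (negbTE k0) (conjdiag_orthodiag PdM).
rewrite /sqrtmx /cosmx /sinmx mxfun_conjdiag // scale_conjdiag.
rewrite !mxfun_conjdiag // invmx_conjdiag // ?mul_conjdiag // => j.
by rewrite gt_eqF // sqrtr_gt0.
Qed.

Lemma rderive0_cst (y : R -> 'cV[R]_n) s :
  (forall r, rderive y r 0) -> y s = y 0.
Proof.
move=> yD; apply/colP => i.
apply: (@is_derive_0_is_cst R (fun s => y s i 0)) => r.
by have := yD r i; rewrite mxE.
Qed.

Lemma free_uniq_real (x y : R -> 'cV[R]_n) t : (forall s, rderive x s (y s)) ->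
  (forall s, rderive y s 0) -> x t = x 0 + t *: y 0.
Proof.
move=> xD yD; apply/colP => i; rewrite !mxE.
pose h s := x s i 0 - s * y 0 i 0.
have hD s : is_derive s 1 h 0.
  have xD' := xD s i; rewrite (rderive0_cst _ yD) in xD'.
  apply: is_derive_eq; rewrite /GRing.scale /=; ring.
have := is_derive_0_is_cst t 0 hD; rewrite /h mul0r subr0 => <-.
by rewrite subrK.
Qed.

(* If the matrices - M k are positive definite for k != 0, then wave_solution is
   the unique solution of the initial value problem. *)
Theorem wave_solution_ivp (M : 'cV[int]_n -> 'M[R]_n) (f g : pdist R n)
    (U : R -> pdist R n) :
  M 0 = 0 ->
  (forall k, k != 0 -> exists P d,
     orthodiag P d (- M k) /\ forall j, 0 < d 0 j) ->
  wave_ivp M f g U <-> U = wave_solution M f g.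
Proof.
move=> M0 MP; split=> [[V [U0 V0 UD VD]]|->].
  apply/funext => t; apply/funext => k.
  have U0k : U 0 k = f k by rewrite U0.
  have V0k : V 0 k = g k by rewrite V0.
  have UDk s := (cderiveP _ _ _).1 (UD s k).
  have VDk s := (cderiveP _ _ _).1 (VD s k).
  have [k0|k0] := eqVneq k 0.
    rewrite /wave_solution k0 eqxx -k0 -U0k -V0k.
    have M0U s : cmx (M k) *m U s k = 0 by rewrite k0 M0 /cmx raddf0 mul0mx.
    have r0 : rpart 0 = 0 by apply/colP => i; rewrite !mxE.
    have i0 : ipart 0 = 0 by apply/colP => i; rewrite !mxE.
    apply: part_inj; rewrite (rpartD, ipartD) (rpartZ, ipartZ).
    - apply: (free_uniq_real (x := fun s => rpart (U s k))
        (y := fun s => rpart (V s k))) => s; first by have [] := UDk s.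
      by have [+ _] := VDk s; rewrite M0U r0.
    - apply: (free_uniq_real (x := fun s => ipart (U s k))
        (y := fun s => ipart (V s k))) => s; first by have [] := UDk s.
      by have [_ +] := VDk s; rewrite M0U i0.
  have [P [d [PdM d0]]] := MP k k0.
  rewrite (wave_solution_conjdiag _ _ _ k0 PdM d0) -U0k -V0k.
  apply: part_inj; rewrite (rpartD, ipartD) !(rpart_mul, ipart_mul).
  - apply: (wave_uniq_real (x := fun s => rpart (U s k))
      (y := fun s => rpart (V s k)) _ PdM d0) => s; first by have [] := UDk s.
    by have [+ _] := VDk s; rewrite opprK -rpart_mul.
  - apply: (wave_uniq_real (x := fun s => ipart (U s k))
      (y := fun s => ipart (V s k)) _ PdM d0) => s; first by have [] := UDk s.
    by have [_ +] := VDk s; rewrite opprK -ipart_mul.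
pose S k := sqrtmx (- M k).
pose V t k := if k == 0 then g 0 else
  cmx (- (S k *m sinmx (t *: S k))) *m f k + cmx (cosmx (t *: S k)) *m g k.
exists V.
have wD (w : R) s : is_derive s 1 (fun s : R => s * w) w.
  by apply: is_derive_eq; rewrite scaler0 add0r [_%:A]mulr1.
have cD w s : is_derive s 1 (fun s => cos (s * w)) (- sin (s * w) * w).
  exact: is_derive1_comp (wD w s).
have sD w s : is_derive s 1 (fun s => sin (s * w)) (cos (s * w) * w).
  exact: is_derive1_comp (wD w s).
have sD' w s : 0 < w -> is_derive s 1 (fun s => sin (s * w) / w) (cos (s * w)).
  move=> w0; have := sD w s; have w1 := lt0r_neq0 w0.
  by move=> ?; apply: is_derive_eq; rewrite /GRing.scale /=; field.
have VE k P d t : k != 0 -> orthodiag P d (- M k) -> (forall j, 0 < d 0 j) ->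
    V t k = cmx (conjdiag P (fun j => - sin (t * Num.sqrt (d 0 j)) *
                                        Num.sqrt (d 0 j))) *m f k +
            cmx (conjdiag P (fun j => cos (t * Num.sqrt (d 0 j)))) *m g k.
  move=> k0 PdM d0; have [PP _] := PdM.
  rewrite /V (negbTE k0) /S (conjdiag_orthodiag PdM).
  rewrite /sqrtmx /cosmx /sinmx mxfun_conjdiag // scale_conjdiag.
  rewrite !mxfun_conjdiag // mul_conjdiag // -scaleN1r scale_conjdiag.
  congr (cmx (conjdiag _ _) *m _ + _); apply/funext => j.
  by rewrite mulN1r mulrC mulNr.
split.
- apply/funext => k; have [->|k0] := eqVneq k 0.
    by rewrite /wave_solution eqxx scale0r addr0.
  have [P [d [PdM d0]]] := MP k k0; have [PP _] := PdM.
  rewrite (wave_solution_conjdiag _ _ _ k0 PdM d0).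
  have c1 : conjdiag P (fun j => cos (0 * Num.sqrt (d 0 j))) = 1%:M.
    rewrite /conjdiag (_ : diag_mx _ = 1%:M) ?mulmx1 //.
    by apply/matrixP => i j; rewrite !mxE mul0r cos0.
  have s0 : conjdiag P (fun j => sin (0 * Num.sqrt (d 0 j)) /
      Num.sqrt (d 0 j)) = 0.
    rewrite /conjdiag (_ : diag_mx _ = 0) ?mulmx0 ?mul0mx //.
    by apply/matrixP => i j; rewrite !mxE mul0r sin0 mul0r mul0rn.
  by rewrite c1 s0 /cmx map_mx1 raddf0 mul1mx mul0mx addr0.
- apply/funext => k; have [->|k0] := eqVneq k 0; first by rewrite /V eqxx.
  have [P [d [PdM d0]]] := MP k k0; have [PP _] := PdM.
  rewrite (VE _ _ _ _ k0 PdM d0).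
  have c1 : conjdiag P (fun j => cos (0 * Num.sqrt (d 0 j))) = 1%:M.
    rewrite /conjdiag (_ : diag_mx _ = 1%:M) ?mulmx1 //.
    by apply/matrixP => i j; rewrite !mxE mul0r cos0.
  have s0 : conjdiag P (fun j => - sin (0 * Num.sqrt (d 0 j)) *
      Num.sqrt (d 0 j)) = 0.
    rewrite /conjdiag (_ : diag_mx _ = 0) ?mulmx0 ?mul0mx //.
    by apply/matrixP => i j; rewrite !mxE mul0r sin0 oppr0 mul0r mul0rn.
  by rewrite c1 s0 /cmx map_mx1 raddf0 mul1mx mul0mx add0r.
- move=> t k; have [->|k0] := eqVneq k 0.
    rewrite /V eqxx => i; under eq_fun do rewrite /wave_solution eqxx.
    under [in X in _ /\ X]eq_fun do rewrite /wave_solution eqxx.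
    under eq_fun do rewrite !mxE; under [in X in _ /\ X]eq_fun do rewrite !mxE.
    case: (f 0 i 0) (g 0 i 0) => a b [c e] /=.
    by split; apply: is_derive_eq; rewrite /GRing.scale /=; ring.
  have [P [d [PdM d0]]] := MP k k0.
  under eq_fun do rewrite (wave_solution_conjdiag _ _ _ k0 PdM d0).
  rewrite (VE _ _ _ _ k0 PdM d0).
  apply/cderiveP; split; under eq_fun do rewrite (rpartD, ipartD)
    !(rpart_mul, ipart_mul); rewrite (rpartD, ipartD) !(rpart_mul, ipart_mul);
  apply: rderiveD; apply: rderive_conjdiag => j;
  by apply: sD'; rewrite sqrtr_gt0.
- move=> t k; have [->|k0] := eqVneq k 0.
    rewrite M0 /cmx raddf0 mul0mx /V eqxx => i.
    by rewrite mxE; split; exact: is_derive_cst.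
  have [P [d [PdM d0]]] := MP k k0; have [PP _] := PdM.
  under eq_fun do rewrite (VE _ _ _ _ k0 PdM d0).
  rewrite (wave_solution_conjdiag _ _ _ k0 PdM d0) mulmxDr !mulmxA -!map_mxM /=.
  have -> : M k = conjdiag P (fun j => - d 0 j).
    rewrite -[LHS]opprK (conjdiag_orthodiag PdM) -scaleN1r scale_conjdiag.
    by congr conjdiag; apply/funext => j; rewrite mulN1r.
  rewrite !mul_conjdiag //.
  apply/cderiveP; split; under eq_fun do rewrite (rpartD, ipartD)
    !(rpart_mul, ipart_mul); rewrite (rpartD, ipartD) !(rpart_mul, ipart_mul);
  apply: rderiveD; apply: rderive_conjdiag => j;
  have dE : d 0 j = Num.sqrt (d 0 j) ^+ 2 by rewrite sqr_sqrtr // ltW.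
  all: have w0 : Num.sqrt (d 0 j) != 0 by rewrite gt_eqF // sqrtr_gt0.
  1,3: have -> : - d 0 j * cos (t * Num.sqrt (d 0 j)) =
    - (cos (t * Num.sqrt (d 0 j)) * Num.sqrt (d 0 j)) * Num.sqrt (d 0 j)
    by rewrite {1}dE; ring.
  1,2: by apply: is_derive_eq; rewrite /GRing.scale /=; ring.
  all: have -> : - d 0 j * (sin (t * Num.sqrt (d 0 j)) / Num.sqrt (d 0 j)) =
    - sin (t * Num.sqrt (d 0 j)) * Num.sqrt (d 0 j)
    by rewrite {1}dE; field.
  all: exact: cD.
Qed.
End WaveSolutions.

Section Solutions.
Context {R : realType} {n : nat}.

Lemma freq_eq0 (k : 'cV[int]_n) : (freq k == 0 :> 'cV[R]_n) = (k == 0).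
Proof.
apply/eqP/eqP => [/colP k0|->]; last exact: raddf0.
by apply/colP => i; have := k0 i; rewrite !mxE => /eqP; rewrite intr_eq0 => /eqP.
Qed.

Theorem peridynamic_solution_ivp (delta lam mu beta : R) (f g : pdist R n)
    (U : R -> pdist R n) :
  (forall nu : 'cV[R]_n, nu != 0 -> lambda1 delta lam mu beta nu < 0) ->
  (forall nu : 'cV[R]_n, nu != 0 -> lambda2 delta mu beta nu < 0) ->
  wave_ivp (fun k => perimx delta lam mu beta (freq k)) f g U <->
  U = peridynamic_solution delta lam mu beta f g.
Proof.
move=> l1 l2; apply: wave_solution_ivp; first by rewrite /freq raddf0 perimx0.
move=> k k0; have nu0 : freq k != 0 :> 'cV[R]_n by rewrite freq_eq0.
set nu := freq k in nu0 *.
have [P [d [PdA dE]]] := rank1_orthodiag (- lambda2 delta mu beta nu)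
  (lambda2 delta mu beta nu - lambda1 delta lam mu beta nu) nu0.
exists P, d; split.
  rewrite /perimx; set a := lambda1 _ _ _ _ _; set b := lambda2 _ _ _ _.
  have <- : (- b)%:M + ((b - a) / sqnorm nu) *: (nu *m nu^T) =
      - (b%:M + ((a - b) / sqnorm nu) *: (nu *m nu^T)).
    by rewrite [(- b)%:M]raddfN opprD -(opprB a b) mulNr scaleNr.
  exact: PdA.
by move=> j; case: (dE j) => ->; rewrite ?addKr oppr_gt0 ?l1 ?l2.
Qed.

Theorem navier_solution_ivp (lam mu : R) (f g : pdist R n)
    (U : R -> pdist R n) :
  0 < mu -> 0 < lam + 2 * mu ->
  wave_ivp (fun k => naviermx lam mu (freq k)) f g U <->
  U = navier_solution lam mu f g.
Proof.
move=> mu0 lmu0; apply: wave_solution_ivp.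
  have s0 : sqnorm (0 : 'cV[R]_n) = 0 by apply/eqP; rewrite sqnorm_eq0.
  by rewrite /freq raddf0 /naviermx mul0mx scaler0 s0 mulr0 !raddf0 addr0.
move=> k k0; have nu0 : freq k != 0 :> 'cV[R]_n by rewrite freq_eq0.
set nu := freq k in nu0 *.
have N0 : 0 < sqnorm nu by rewrite lt_def sqnorm_eq0 nu0 sqnorm_ge0.
have [P [d [PdA dE]]] := rank1_orthodiag (mu * sqnorm nu)
  ((lam + mu) * sqnorm nu) nu0.
exists P, d; split.
  rewrite /naviermx opprD !opprK addrC.
  by rewrite mulfK ?lt0r_neq0 in PdA.
move=> j; case: (dE j) => ->; first exact: mulr_gt0.
by rewrite -mulrDl mulr_gt0 // addrC -addrA -mulr2n -mulr_natl.
Qed.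

End Solutions.

(* Main.v *)
Require Import Defs.
From HB Require Import structures.
From mathcomp Require Import all_boot all_order all_algebra.
From mathcomp Require Import all_classical all_reals all_analysis.
From mathcomp Require Import complex ring lra.

Set Implicit Arguments.
Unset Strict Implicit.
Unset Printing Implicit Defensive.

Import Order.TTheory GRing.Theory Num.Theory.
Import numFieldNormedType.Exports.

Local Open Scope classical_set_scope.
Local Open Scope ring_scope.

(** On the frequency [nu] both evolutions are driven by a symmetric matrix with
    one eigenvalue on the line of [nu] and one on its orthogonal complement, so
    solutions are compared through the scalars [cos (t w)] and [sin (t w) / w],
    where [- w ^+ 2] is the eigenvalue. The theorem follows by dominated
    convergence over the frequencies ([wave_solution_cvg]) from two facts about
    the eigenvalues: each tends to its Navier counterpart, and, uniformly for
    [beta] close to [n + 2], their absolute value is at least a constant times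
    [|nu| `^ (2 - eps)] at high frequency. The second fact bounds
    [(sin (t w) / w) ^+ 2 * |nu| `^ (2 - eps)], which is why [g] gains
    [(2 - eps) / 2] derivatives, while at low frequency [sin (t w) / w] is at
    most [t].

    Put [y = |nu| ^+ 2 * delta ^+ 2 / 4], [c = n / 2 + 1] and
    [a = (n + 2 - beta) / 2], which tends to 0 from the right. In all
    hypergeometric functions involved, [beta] only enters through the ratio
    [(a)_m / (a + 1)_m = a / (a + m)]. With [X = \sum_m x_m y ^ m] and
    [X_a = \sum_m (a / (a + m)) x_m y ^ m] they are expressed by
    [F = 0F1(; c; - y)] and by [G], the mean of [0F1(; c + 1; - .)] over
    [[0, y]], as follows: the 1F2 is [F_a], the 2F3 is [G_a] and the 3F4 is
    [(1 - 2 a / 3) G_a + (2 a / 3) G]. As [a] tends to 0 the weights kill every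
    term but the first, so [X_a] tends to 1, which gives the limits of the
    eigenvalues ([transverse_cvg], [longitudinal_cvg]).

    The growth comes from [y X_a' + a X_a = a X], that is
    [(y `^ a X_a)' = a y `^ (a - 1) X]. Two energies of the Bessel equation
    [y F'' + c F' + F = 0] show [F ^+ 2 <= 1] and [y F ^+ 2 <= c]. The first one
    and [y G = c (1 - F)] give [G >= 0], so [y `^ a G_a] is nondecreasing: for
    [y >= 1] it is at least [G_a(1)], which is close to 1. This settles the
    transverse eigenvalue. The second one gives
    [(y `^ a F_a ^+ 2)' <= a y `^ (a - 1) F ^+ 2 <= a c y `^ (a - 2)], so
    [y `^ a F_a ^+ 2 <= F_a(1) ^+ 2 + a c / (1 - a)], which is close to 1. Hence
    the longitudinal symbol times [y `^ a] is at least about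
    [3 mu - max(0, mu - lam)], and this is positive because [mu] and
    [lam + 2 mu] are ([longitudinal_lower]). *)

(** * Power series with coefficients bounded by inverse factorials *)

Section EntireSeries.
Context {R : realType}.
Implicit Types (c d : nat -> R) (x y : R).

(** This class is closed under derivation, shifts and bounded weights, and its
    series converge everywhere, dominated by the exponential. *)
Definition fact_bounded c := forall m, `|c m| <= (m`!%:R)^-1.

Definition psum c x : R := limn (pseries c x).

Lemma is_cvg_pseries_fact_bounded c x : fact_bounded c -> cvgn (pseries c x).
Proof.
move=> cB; apply: normed_cvg.
apply: (@series_le_cvg _ _ (exp_coeff `|x|)) => [m|m|m|] //=.
- by rewrite exp_coeff_ge0.
- by rewrite normrM normrX /exp_coeff /= mulrC ler_wpM2l // exprn_ge0.
- exact: is_cvg_series_exp_coeff.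
Qed.

Lemma cvg_psum c x : fact_bounded c -> pseries c x n @[n --> \oo] --> psum c x.
Proof. exact: is_cvg_pseries_fact_bounded. Qed.

Lemma norm_psum_le c x : fact_bounded c -> `|psum c x| <= expR `|x|.
Proof.
move=> cB.
have bound m : `|c m * x ^+ m| <= exp_coeff `|x| m.
  by rewrite normrM normrX /exp_coeff /= mulrC ler_wpM2l // exprn_ge0.
have ncv : cvgn [normed series (fun m => c m * x ^+ m)].
  apply: (@series_le_cvg _ _ (exp_coeff `|x|)) => [m|m|m|] //=.
  - by rewrite exp_coeff_ge0.
  - exact: is_cvg_series_exp_coeff.
apply: le_trans (lim_series_norm ncv) _.
apply: lim_series_le => //; exact: is_cvg_series_exp_coeff.
Qed.

Lemma fact_bounded_diffs c : fact_bounded c -> fact_bounded (pseries_diffs c).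
Proof.
move=> cB m; rewrite /pseries_diffs normrM ger0_norm //.
rewrite -ler_pdivlMl ?ltr0n // -invfM -natrM -factS; exact: cB.
Qed.

Lemma fact_bounded_shift c : fact_bounded c -> fact_bounded (fun m => c m.+1).
Proof.
move=> cB m; apply: le_trans (cB m.+1) _.
by rewrite lef_pV2 ?posrE ?ltr0n ?fact_gt0 // ler_nat factS leq_pmull.
Qed.

Lemma fact_bounded_weight (w c : nat -> R) :
  (forall m, `|w m| <= 1) -> fact_bounded c ->
  fact_bounded (fun m => w m * c m).
Proof.
by move=> w1 cB m; rewrite normrM -[leRHS]mul1r ler_pM.
Qed.

Lemma psum_derive c x : fact_bounded c ->
  is_derive x 1 (psum c) (psum (pseries_diffs c) x).
Proof.
move=> cB; apply: (@pseries_snd_diffs _ c (`|x| + 1)).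
- exact: is_cvg_pseries_fact_bounded.
- exact/is_cvg_pseries_fact_bounded/fact_bounded_diffs.
- exact/is_cvg_pseries_fact_bounded/fact_bounded_diffs/fact_bounded_diffs.
- by rewrite [ltRHS]ger0_norm ?addr_ge0 // ltrDl.
Qed.

Lemma psum_lin (a b : R) c d x : fact_bounded c -> fact_bounded d ->
  psum (fun m => a * c m + b * d m) x = a * psum c x + b * psum d x.
Proof.
move=> cB dB; apply/cvg_lim => //.
have cc : a * pseries c x n @[n --> \oo] --> a * psum c x.
  by apply: cvgMl_tmp; exact: cvg_psum.
have cd : b * pseries d x n @[n --> \oo] --> b * psum d x.
  by apply: cvgMl_tmp; exact: cvg_psum.
apply: cvg_trans (cvgD cc cd).
apply: near_eq_cvg; apply: nearW => m.
rewrite fctE /pseries /series /= !mulr_sumr -big_split /=.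
by apply: eq_bigr => i _; rewrite mulrDl !mulrA.
Qed.

(** Splitting off the constant term turns an identity between series involving
    a factor [x] into one between coefficients, through [psum_lin]. *)
Lemma psum_shift c x : fact_bounded c ->
  psum c x = c 0%N + x * psum (fun m => c m.+1) x.
Proof.
move=> cB; apply/cvg_lim => //.
have cs : x * pseries (fun m => c m.+1) x n @[n --> \oo] -->
    x * psum (fun m => c m.+1) x.
  by apply: cvgMl_tmp; apply: cvg_psum; exact: fact_bounded_shift.
rewrite -cvg_shiftS; apply: cvg_trans (cvgD (cvg_cst (c 0%N)) cs).
apply: near_eq_cvg; apply: nearW => m.
rewrite /pseries /series /= big_nat_recl //= expr0 mulr1 fctE /=; congr (_ + _).
rewrite mulr_sumr; apply: eq_bigr => i _; rewrite exprS; ring.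
Qed.

Lemma is_derive_le0_le (f df : R -> R) a b : a <= b ->
  (forall x, a <= x <= b -> is_derive x 1 f (df x)) ->
  (forall x, a <= x <= b -> df x <= 0) -> f b <= f a.
Proof.
move=> ab fD df0.
have D x : x \in `[a, b] -> is_derive x 1 f (df x) by rewrite in_itv; exact: fD.
apply: (@ler0_derive1_le_cc _ f a b) => //.
- by move=> x /subset_itv_oo_cc /D [].
- move=> x xab; have xab' := subset_itv_oo_cc xab.
  have [? fx] := D x xab'; rewrite derive1E fx; apply: df0.
  by move: xab'; rewrite in_itv.
- apply: derivable_within_continuous => x /D [] //.
- by rewrite in_itv /= ab lexx.
- by rewrite in_itv /= ab lexx.
Qed.

End EntireSeries.

(** * Series weighted by [a / (a + m)] *)

Section WeightedSeries.
Context {R : realType}.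
Implicit Types (a x : R) (c : nat -> R).

(** The series of [avg a c] at [x] is the average of the series of [c] over
    [[0, x]] for the density proportional to [s `^ (a - 1)]. *)
Definition avg a c (m : nat) : R := a / (a + m%:R) * c m.

Lemma fact_bounded_avg a c : 0 < a -> fact_bounded c -> fact_bounded (avg a c).
Proof.
move=> a0; apply: (@fact_bounded_weight _ (fun m => a / (a + m%:R))) => m.
have am : 0 < a + m%:R by rewrite ltr_wpDr.
by rewrite ger0_norm ?(divr_ge0 (ltW a0) (ltW am)) // ler_pdivrMr // mul1r lerDl.
Qed.

(** The Euler operator [x d/dx + a] multiplies the coefficient of index [m] by
    [m + a], which undoes the weight up to the factor [a]. *)
Lemma psum_avg_ode a c x : 0 < a -> fact_bounded c ->
  x * psum (pseries_diffs (avg a c)) x + a * psum (avg a c) x = a * psum c x.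
Proof.
move=> a0 cB; have aB := fact_bounded_avg a0 cB.
rewrite [psum (avg a c) x]psum_shift // [psum c x]psum_shift //.
have -> : avg a c 0%N = c 0%N by rewrite /avg addr0 divff ?mul1r ?gt_eqF.
suff: 1 * psum (pseries_diffs (avg a c)) x + a * psum (fun m => avg a c m.+1) x
    = a * psum (fun m => c m.+1) x + 0 * psum c x.
  by move=> E; have := congr1 (fun z => x * z) E; lra.
have adB := fact_bounded_diffs aB; have asB := fact_bounded_shift aB.
have csB := fact_bounded_shift cB; rewrite -!psum_lin //.
congr psum; apply/funext => m; rewrite /pseries_diffs /avg.
by field; rewrite gt_eqF // ltr_pwDl.
Qed.

(** For [m >= 1] the weight [a / (a + m)] is at most [a], so [a] factors out of
    everything but the constant term. *)
Lemma psum_avg_near a c x : 0 < a -> fact_bounded c ->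
  `|psum (avg a c) x - c 0%N| <= a * expR `|x|.
Proof.
move=> a0 cB; have aB := fact_bounded_avg a0 cB.
pose e m := (m != 0)%:R / (a + m%:R) * c m.
have eB : fact_bounded e.
  apply: (@fact_bounded_weight _ (fun m => (m != 0)%:R / (a + m%:R))) cB => -[|m].
    by rewrite mul0r normr0.
  have am : 0 < a + m.+1%:R by rewrite ltr_wpDr.
  rewrite div1r ger0_norm ?invr_ge0 ?(ltW am) // invf_le1 //.
  by rewrite -[leLHS]add0r lerD ?(ltW a0) // ler1n.
have -> : psum (avg a c) x - c 0%N = a * psum e x.
  rewrite psum_shift // (psum_shift _ eB) /e eqxx !mul0r add0r.
  have -> : avg a c 0%N = c 0%N by rewrite /avg addr0 divff ?mul1r ?gt_eqF.
  rewrite (_ : (fun m => avg a c m.+1) =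
    (fun m => a * e m.+1 + 0 * e m.+1)); last first.
    by apply/funext => m; rewrite /avg /e /= mul0r addr0 div1r mulrA.
  have esB := fact_bounded_shift eB; by rewrite psum_lin // /e; ring.
by rewrite normrM gtr0_norm // ler_pM2l // norm_psum_le.
Qed.

End WeightedSeries.

(** * The Bessel function in the variable [y] *)

Section BesselSeries.
Context {R : realType}.
Implicit Types (c x : R).

Lemma pochhammerSr c m : pochhammer c m.+1 = pochhammer c m * (c + m%:R).
Proof. by rewrite /pochhammer big_ord_recr. Qed.

Lemma pochhammerSl c m : pochhammer c m.+1 = c * pochhammer (c + 1) m.
Proof.
rewrite /pochhammer big_ord_recl /= addr0; congr (_ * _).
by apply: eq_bigr => i _; rewrite /bump /= natrD addrA.
Qed.

Lemma pochhammer0 c : pochhammer c 0 = 1.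
Proof. by rewrite /pochhammer big_ord0. Qed.

Lemma pochhammer_gt0 c m : 0 < c -> 0 < pochhammer c m.
Proof. by move=> c0; apply: prodr_gt0 => i _; rewrite ltr_pwDl. Qed.

Lemma pochhammer_ge1 c m : 1 <= c -> 1 <= pochhammer c m.
Proof.
move=> c1; elim: m => [|m IH]; first by rewrite pochhammer0.
by rewrite pochhammerSr mulr_ege1 // (le_trans c1) // lerDl.
Qed.

Lemma fact_neq0 m : (m`!%:R : R) != 0.
Proof. by rewrite pnatr_eq0 -lt0n fact_gt0. Qed.

(** The coefficients of [0F1(; c; - y)], which is the Bessel function of order
    [c - 1] at [2 sqrt y], renormalised to be 1 at the origin. *)
Definition bessel c (m : nat) : R := (-1) ^+ m / (pochhammer c m * m`!%:R).

(** The coefficients of the mean of [0F1(; c + 1; - .)] over [[0, y]]. *)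
Definition bessel_mean c (m : nat) : R :=
  (-1) ^+ m / (pochhammer (c + 1) m * m.+1`!%:R).

Lemma fact_bounded_bessel c : 1 <= c -> fact_bounded (bessel c).
Proof.
move=> c1 m; rewrite /bessel normrM normrX normrN1 expr1n mul1r invfM normrM.
rewrite (ger0_norm (_ : 0 <= m`!%:R^-1)) // -[leRHS]mul1r ler_wpM2r //.
have p1 := pochhammer_ge1 m c1.
by rewrite ger0_norm ?invf_le1 ?invr_ge0 ?(lt_le_trans ltr01) // (le_trans ler01).
Qed.

Lemma fact_bounded_bessel_mean c : 1 <= c -> fact_bounded (bessel_mean c).
Proof.
move=> c1; rewrite (_ : bessel_mean c =
    fun m => m.+1%:R^-1 * bessel (c + 1) m); last first.
  apply/funext => m; rewrite /bessel_mean /bessel factS natrM.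
  have c10 : 0 < c + 1 by lra.
  have f0 := fact_neq0 m; have p0 := lt0r_neq0 (pochhammer_gt0 m c10).
  by field; rewrite f0 p0 addrC natr1 pnatr_eq0.
apply: (@fact_bounded_weight _ (fun m => m.+1%:R^-1)) => [m|]; last first.
  by apply: fact_bounded_bessel; rewrite (le_trans c1) // lerDl.
by rewrite ger0_norm // invf_le1 // ler1n.
Qed.

Lemma bessel0 c : bessel c 0%N = 1.
Proof. by rewrite /bessel pochhammer0 mul1r divr1. Qed.

Lemma bessel_mean0 c : bessel_mean c 0%N = 1.
Proof. by rewrite /bessel_mean pochhammer0 mul1r divr1. Qed.

Lemma besselS c m : 0 < c ->
  m.+1%:R * (c + m%:R) * bessel c m.+1 = - bessel c m.
Proof.
move=> c0; rewrite /bessel pochhammerSr factS natrM exprS.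
have f0 := fact_neq0 m; have p0 := lt0r_neq0 (pochhammer_gt0 m c0).
have cm0 : c + m%:R != 0 by rewrite gt_eqF // ltr_pwDl.
by field; rewrite f0 cm0 p0 addrC natr1 pnatr_eq0.
Qed.

Local Notation F c := (psum (bessel c)).
Local Notation F' c := (psum (pseries_diffs (bessel c))).
Local Notation F'' c := (psum (pseries_diffs (pseries_diffs (bessel c)))).
Local Notation G c := (psum (bessel_mean c)).

Lemma psum_bessel0 c : 1 <= c -> F c 0 = 1.
Proof.
move=> c1; have bB := fact_bounded_bessel c1.
by rewrite psum_shift // mul0r addr0 bessel0.
Qed.

Lemma bessel_ode c x : 1 <= c -> x * F'' c x + c * F' c x + F c x = 0.
Proof.
move=> c1; have bB := fact_bounded_bessel c1.
have c0 : 0 < c := lt_le_trans ltr01 c1.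
have dB := fact_bounded_diffs bB; have ddB := fact_bounded_diffs dB.
rewrite [psum (bessel c) x]psum_shift //.
rewrite [psum (pseries_diffs (bessel c)) x]psum_shift //.
have E0 : c * pseries_diffs (bessel c) 0%N + bessel c 0%N = 0.
  by have := besselS 0 c0; rewrite /pseries_diffs addr0; lra.
suff : 1 * F'' c x + c * psum (fun m => pseries_diffs (bessel c) m.+1) x =
    (-1) * psum (fun m => bessel c m.+1) x + 0 * psum (bessel c) x.
  by move=> E; have := congr1 (fun z => x * z) E; lra.
have sB := fact_bounded_shift bB; have dsB := fact_bounded_shift dB.
rewrite -!psum_lin //.
congr psum; apply/funext => m; rewrite /pseries_diffs.
have := besselS m.+1 c0; rewrite -[m.+2%:R]natr1 -[m.+1%:R]natr1; nra.
Qed.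

(** The derivative of [0F1(; c; - .)] is [- 0F1(; c + 1; - .) / c], so the mean
    of the latter is a difference quotient of the former. *)
Lemma bessel_meanE c x : 1 <= c -> x * G c x = c * (1 - F c x).
Proof.
move=> c1; have bB := fact_bounded_bessel c1; have mB := fact_bounded_bessel_mean c1.
have c0 : 0 < c := lt_le_trans ltr01 c1.
rewrite [psum (bessel c) x]psum_shift // bessel0 (_ : bessel_mean c =
    fun m => (- c) * bessel c m.+1 + 0 * bessel c m.+1); last first.
  apply/funext => m; rewrite /bessel_mean /bessel pochhammerSl exprS.
  have c10 : 0 < c + 1 by lra.
  have f0 := fact_neq0 m.+1; have p0 := lt0r_neq0 (pochhammer_gt0 m c10).
  by field; rewrite f0 p0 (lt0r_neq0 c0).
have sB := fact_bounded_shift bB; rewrite psum_lin //; ring.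
Qed.

Let dF c x : 1 <= c -> is_derive x 1 (F c) (F' c x).
Proof. by move=> c1; apply: psum_derive; exact: fact_bounded_bessel. Qed.

Let dF' c x : 1 <= c -> is_derive x 1 (F' c) (F'' c x).
Proof.
by move=> c1; apply: psum_derive; apply: fact_bounded_diffs; exact: fact_bounded_bessel.
Qed.

(** The energy [F ^+ 2 + y F' ^+ 2] has derivative [(1 - 2 c) F' ^+ 2] along the
    Bessel equation, and equals 1 at the origin. *)
Lemma bessel_sqr_le1 c x : 1 <= c -> 0 <= x -> F c x ^+ 2 <= 1.
Proof.
move=> c1 x0; pose E x := F c x ^+ 2 + x * F' c x ^+ 2.
suff : E x <= E 0.
  rewrite /E mul0r addr0 psum_bessel0 // expr1n; apply: le_trans.
  by rewrite lerDl mulr_ge0 // sqr_ge0.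
apply: (@is_derive_le0_le _ E (fun y => (1 - 2 * c) * F' c y ^+ 2)) => //.
- move=> y _; have DF := dF y c1; have DF' := dF' y c1.
  apply: is_derive_eq; rewrite /GRing.scale /=.
  by have := bessel_ode y c1; nra.
- by move=> y _; rewrite mulr_le0_ge0 ?sqr_ge0 //; lra.
Qed.

(** The quantity [Q] below has derivative [(3 - 2 c) y F' ^+ 2]; it dominates
    [y F ^+ 2] up to bounded terms because it contains the square of
    [y F' + F / 2]. The bound [3 / 2 <= c] is the case of dimension at least 1. *)
Lemma bessel_sqr_decay c x : 3 / 2 <= c -> 0 <= x -> x * F c x ^+ 2 <= c.
Proof.
move=> c32 x0; have c1 : 1 <= c by lra.
pose Q x := x * F c x ^+ 2 + x * x * F' c x ^+ 2 + x * F c x * F' c x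
  + (c - 1) / 2 * F c x ^+ 2.
have : Q x <= Q 0.
  apply: (@is_derive_le0_le _ Q (fun y => (3 - 2 * c) * (y * F' c y ^+ 2))) => //.
  - move=> y _; have DF := dF y c1; have DF' := dF' y c1.
    apply: is_derive_eq; rewrite /GRing.scale /=.
    have -> : F c y = - (y * F'' c y + c * F' c y).
      by have := bessel_ode y c1; lra.
    by field.
  - move=> y /andP[y0 _]; apply: mulr_le0_ge0; [lra | by rewrite mulr_ge0 ?sqr_ge0].
rewrite /Q !mul0r !add0r psum_bessel0 // expr1n mulr1.
(* [x * x * F' ^+ 2 + x * F * F'] is this square up to [- F ^+ 2 / 4]. *)
have := bessel_sqr_le1 c1 x0; have := sqr_ge0 (x * F' c x + F c x / 2).
have := sqr_ge0 (F c x); nra.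
Qed.

Lemma bessel_mean_ge0 c x : 1 <= c -> 0 < x -> 0 <= G c x.
Proof.
move=> c1 x0; have x0' := ltW x0.
rewrite -(pmulr_rge0 _ x0) bessel_meanE //; apply: mulr_ge0; first by lra.
have := bessel_sqr_le1 c1 x0'; case: (lerP (F c x) 1) => F1.
  by rewrite subr_ge0.
nra.
Qed.

End BesselSeries.

(** * The hypergeometric functions and their growth *)

Section HypergeometricSymbols.
Context {R : realType}.
Implicit Types (a c y : R).

Lemma pochhammer1 m : pochhammer 1 m = m`!%:R :> R.
Proof.
elim: m => [|m IH]; first by rewrite pochhammer0.
by rewrite pochhammerSr IH factS natrM mulrC nat1r.
Qed.

Lemma pochhammer_ratio a m : 0 < a ->
  pochhammer a m / pochhammer (a + 1) m = a / (a + m%:R).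
Proof.
move=> a0; have a10 : 0 < a + 1 by lra.
have p0 := lt0r_neq0 (pochhammer_gt0 m a10).
have am0 : a + m%:R != 0 by rewrite gt_eqF // ltr_pwDl.
apply/eqP; rewrite eqr_div // -pochhammerSr pochhammerSl; apply/eqP; ring.
Qed.

Lemma eq_hypergeom (u l : seq R) (d : nat -> R) y :
  (forall m, (\prod_(b <- u) pochhammer b m) / (\prod_(b <- l) pochhammer b m) *
             (-1) ^+ m / m`!%:R = d m) ->
  hypergeom u l (- y) = psum d y.
Proof.
move=> E; rewrite /hypergeom /psum; congr (limn (series _)).
by apply/funext => m /=; rewrite -E [(- y) ^+ m]exprNn; ring.
Qed.

Lemma hypergeom12 a c y : 0 < a -> 0 < c ->
  hypergeom [:: a] [:: c; a + 1] (- y) = psum (avg a (bessel c)) y.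
Proof.
move=> a0 c0; apply: eq_hypergeom => m.
rewrite !big_cons !big_nil /avg -pochhammer_ratio // /bessel.
have a10 : 0 < a + 1 by lra.
have p0 := lt0r_neq0 (pochhammer_gt0 m a10).
have q0 := lt0r_neq0 (pochhammer_gt0 m c0).
by field; rewrite fact_neq0 p0 q0.
Qed.

Lemma hypergeom23 a c y : 0 < a -> 0 < c ->
  hypergeom [:: 1; a] [:: 2; c + 1; a + 1] (- y) =
  psum (avg a (bessel_mean c)) y.
Proof.
move=> a0 c0; apply: eq_hypergeom => m.
rewrite !big_cons !big_nil /avg -pochhammer_ratio // /bessel_mean.
have a10 : 0 < a + 1 by lra.
have c10 : 0 < c + 1 by lra.
have p0 := lt0r_neq0 (pochhammer_gt0 m a10).
have q0 := lt0r_neq0 (pochhammer_gt0 m c10).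
have p2 : pochhammer 2 m = m.+1`!%:R :> R.
  by rewrite -[RHS]pochhammer1 pochhammerSl mul1r.
by rewrite pochhammer1 p2; field; rewrite !fact_neq0 p0 q0.
Qed.

(** The additional ratio [(5/2)_m / (3/2)_m = 1 + 2 m / 3] is affine in [m],
    and [m / (a + m) = 1 - a / (a + m)] brings it back to the weights [avg a]. *)
Lemma hypergeom34 a c y : 0 < a -> 1 <= c ->
  hypergeom [:: 1; 5 / 2; a] [:: 2; 3 / 2; c + 1; a + 1] (- y) =
  (1 - 2 / 3 * a) * psum (avg a (bessel_mean c)) y +
  2 / 3 * a * psum (bessel_mean c) y.
Proof.
move=> a0 c1; have mB := fact_bounded_bessel_mean c1.
have aB := fact_bounded_avg a0 mB.
rewrite -psum_lin //; apply: eq_hypergeom => m.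
rewrite !big_cons !big_nil /avg /bessel_mean.
have a10 : 0 < a + 1 by lra.
have c10 : 0 < c + 1 by lra.
have h0 : (0 : R) < 3 / 2 by lra.
have p0 := lt0r_neq0 (pochhammer_gt0 m a10).
have q0 := lt0r_neq0 (pochhammer_gt0 m c10).
have r0 := lt0r_neq0 (pochhammer_gt0 m h0).
have am0 : a + m%:R != 0 by rewrite gt_eqF // ltr_pwDl.
have p2 : pochhammer 2 m = m.+1`!%:R :> R.
  by rewrite -[RHS]pochhammer1 pochhammerSl mul1r.
have p52 : pochhammer (5 / 2) m = pochhammer (3 / 2) m * (1 + 2 / 3 * m%:R) :> R.
  have -> : 5 / 2 = 3 / 2 + 1 :> R by lra.
  apply: (mulfI (lt0r_neq0 h0)); rewrite -pochhammerSl pochhammerSr; by field.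
have pa : pochhammer a m = a / (a + m%:R) * pochhammer (a + 1) m.
  by rewrite -pochhammer_ratio // divfK.
by rewrite pochhammer1 p2 p52 pa; field; rewrite !fact_neq0 p0 q0 r0 am0.
Qed.

Lemma powR_pred y a : 0 < y -> y `^ a = y * y `^ (a - 1).
Proof.
move=> y0; rewrite -{2}(powRr1 (ltW y0)) -powRD; first by congr (_ `^ _); ring.
by rewrite (gt_eqF y0) implybT.
Qed.

(** By [psum_avg_ode] the derivative of the right-hand side is
    [a * y `^ (a - 1)] times a nonnegative Bessel mean. *)
Lemma powR_mean_nondecr a c y : 0 < a -> 1 <= c -> 1 <= y ->
  psum (avg a (bessel_mean c)) 1 <= y `^ a * psum (avg a (bessel_mean c)) y.
Proof.
move=> a0 c1 y1; have mB := fact_bounded_bessel_mean c1.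
have aB := fact_bounded_avg a0 mB.
set H := psum (avg a _); set H' := psum (pseries_diffs (avg a (bessel_mean c))).
have p1 : 1 `^ a = 1 :> R by rewrite powR1.
rewrite -[H 1]mul1r -[X in X * H 1]p1 -lerN2.
apply: (@is_derive_le0_le _ (fun y => - (y `^ a * H y))
  (fun y => - (a * y `^ (a - 1) * psum (bessel_mean c) y))) => //.
- move=> z /andP[z1 _]; have z0 : 0 < z by lra.
  have DH : is_derive z 1 H (H' z) by exact: psum_derive.
  have Dp := is_derive1_powR a z0.
  have ode := psum_avg_ode z a0 mB; rewrite -/(H z) -/(H' z) in ode.
  apply: is_derive_eq; rewrite /GRing.scale /= [z `^ a]powR_pred //.
  rewrite -mulrA (mulrCA a) -ode; ring.
- move=> z /andP[z1 _]; rewrite oppr_le0 !mulr_ge0 ?powR_ge0 ?(ltW a0) //.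
  by apply: bessel_mean_ge0 => //; lra.
Qed.

(** From [2 B F - B ^+ 2 <= F ^+ 2], the function [y `^ a * B ^+ 2] of the
    weighted series [B] has derivative at most [a y `^ (a - 1) F ^+ 2], hence at
    most [a c y `^ (a - 2)] by [bessel_sqr_decay]; the second term of [Phi]
    absorbs the integral of this bound. *)
Lemma powR_bessel_avg_le a c y : 0 < a -> a < 1 -> 3 / 2 <= c -> 1 <= y ->
  y `^ a * psum (avg a (bessel c)) y ^+ 2 <=
  psum (avg a (bessel c)) 1 ^+ 2 + a * c / (1 - a).
Proof.
move=> a0 a1 c32 y1; have c1 : 1 <= c by lra.
have bB := fact_bounded_bessel c1; have aB := fact_bounded_avg a0 bB.
set B := psum (avg a _); set B' := psum (pseries_diffs (avg a (bessel c))).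
pose F := psum (bessel c).
pose Phi y := y `^ a * B y ^+ 2 + a * c / (1 - a) * y `^ (a - 1).
have : Phi y <= Phi 1.
  apply: (@is_derive_le0_le _ Phi (fun y => y `^ (a - 1 - 1) *
    (a * (2 * y * B y * F y - y * B y ^+ 2 - c)))) => //.
  - move=> z /andP[z1 _]; have z0 : 0 < z by lra.
    have DB : is_derive z 1 B (B' z) by exact: psum_derive.
    have Dp := is_derive1_powR a z0; have Dq := is_derive1_powR (a - 1) z0.
    have ode := psum_avg_ode z a0 bB; rewrite -/(B z) -/(B' z) -/(F z) in ode.
    apply: is_derive_eq; rewrite /GRing.scale /= [z `^ a]powR_pred //.
    rewrite [z `^ (a - 1)]powR_pred // -[2 * z * B z]mulrA.
    set p := z `^ _; set b := B z in ode *; set b' := B' z in ode *; set f := F z in ode *.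
    have -> : a * (2 * (z * b) * f - z * b ^+ 2 - c) =
       2 * z * b * (z * b' + a * b) - a * z * b ^+ 2 - a * c by rewrite ode; ring.
    by field; lra.
  - move=> z /andP[z1 _]; have z0 : 0 <= z by lra.
    rewrite mulr_ge0_le0 ?powR_ge0 // mulr_ge0_le0 ?(ltW a0) //.
    have := bessel_sqr_decay c32 z0; rewrite -/(F z).
    by have := mulr_ge0 z0 (sqr_ge0 (B z - F z)); nra.
rewrite /Phi !powR1 mul1r mulr1; apply: le_trans; rewrite lerDl.
by rewrite mulr_ge0 ?powR_ge0 // divr_ge0 ?mulr_ge0 ?(ltW a0) //; lra.
Qed.

End HypergeometricSymbols.

(** * Dominated convergence for unordered sums *)

Section DominatedSums.
Context {R : realType} {I : choiceType} {T : Type} {F : set_system T}.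
Context {FF : Filter F}.
Implicit Types (u : T -> I -> R) (D : I -> R).

(** Outside a finite set the dominating sum is at most [e / 2]; on that set
    finitely many terms tend to 0. *)
Lemma esum_dominated_cvg0 u D :
  (\forall b \near F, forall i, 0 <= u b i <= D i) ->
  (\esum_(i in [set: I]) (D i)%:E < +oo)%E -> (forall i, 0 <= D i) ->
  (forall i, u b i @[b --> F] --> (0 : R)) ->
  forall e : R, 0 < e ->
  \forall b \near F, (\esum_(i in [set: I]) (u b i)%:E <= e%:E)%E.
Proof.
move=> uD Dfin D0 u0 e e0.
have De0 i : [set: I] i -> (0 <= (D i)%:E)%E by rewrite lee_fin.
have SD : \esum_(i in [set: I]) (D i)%:E \is a fin_num.
  by rewrite ge0_fin_numE ?esum_ge0.
have e20 : 0 < e / 2 by rewrite divr_gt0.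
(* A finite partial sum within [e / 2] of the dominating sum. *)
have [_ [X [Xfin _] <-] XD] := ub_ereal_sup_adherent e20 SD.
have tail : (\esum_(i in ~` X) (D i)%:E <= (e / 2)%:E)%E.
  move: XD; rewrite -/(esum _ _) (esumID X) // !setTI esum_fset //; last first.
    by move=> i _; exact: De0.
  have XF : \sum_(i \in X) (D i)%:E \is a fin_num.
    by rewrite fsumEFin.
  move: XF; case: (\sum_(i \in X) _)%E => // r _.
  have : (0 <= \esum_(i in ~` X) (D i)%:E)%E by apply: esum_ge0 => i _; rewrite lee_fin.
  case: (\esum_(i in ~` X) (D i)%:E)%E => [s| |] //=.
  by rewrite -!EFinD lte_fin !lee_fin; lra.
have head : \forall b \near F, \sum_(i \in X) u b i < e / 2.
  have : (\sum_(i \in X) u b i) @[b --> F] --> \sum_(i \in X) (0 : R).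
    rewrite fsbig_finite //; under eq_fun do rewrite fsbig_finite //.
    by apply: (cvg_big (@add_continuous R)) => i _; exact: u0.
  by rewrite fsbig1 // => /cvgr_lt; apply.
near=> b.
have ub : forall i, 0 <= u b i <= D i by near: b.
have ub0 i : [set: I] i -> (0 <= (u b i)%:E)%E.
  by rewrite lee_fin; case/andP: (ub i).
rewrite (esumID X) // !setTI esum_fset //; last by move=> i _; exact: ub0.
rewrite (splitr e) EFinD leeD //.
- by rewrite fsumEFin // lee_fin ltW //; near: b.
- apply: le_trans tail; apply: le_esum => i _.
  by rewrite lee_fin; case/andP: (ub i).
Unshelve. all: by end_near. Qed.

End DominatedSums.

(** * Functional calculus for the two-eigenvalue matrices *)

Section SpectralMatrices.
Context {R : realType} {n : nat}.
Implicit Types (nu x : 'cV[R]_n) (p q : R) (z : 'cV[R[i]]_n).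

(** The shape common to the peridynamic and Navier matrices: eigenvalue [p] on
    the line of [nu] and [q] on its orthogonal complement. *)
Definition specmx nu p q : 'M[R]_n :=
  q%:M + ((p - q) / sqnorm nu) *: (nu *m nu^T).

Lemma scale_specmx a nu p q : a *: specmx nu p q = specmx nu (a * p) (a * q).
Proof.
by rewrite /specmx scalerDr scale_scalar_mx scalerA mulrA mulrBr.
Qed.

Lemma specmxB nu p q p' q' :
  specmx nu p q - specmx nu p' q' = specmx nu (p - p') (q - q').
Proof.
rewrite /specmx opprD addrACA -scalerBl -mulrBl.
by congr (_ + (_ / _) *: _); [rewrite -raddfB | ring].
Qed.

Lemma mul_specmx nu p q p' q' : nu != 0 ->
  specmx nu p q *m specmx nu p' q' = specmx nu (p * p') (q * q').
Proof.
move=> nu0; have N0 : sqnorm nu != 0 by rewrite sqnorm_eq0.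
rewrite /specmx mulmxDr !mulmxDl -!scalar_mxM -!scalemxAl -!scalemxAr.
rewrite mul_mx_scalar mul_scalar_mx -!mulmxA (mulmxA nu^T) sqnorm_mx.
rewrite mul_scalar_mx -scalemxAr !scalerA -!addrA -!scalerDl.
by congr (_ + _ *: _); field.
Qed.

Lemma tr_specmx nu p q : (specmx nu p q)^T = specmx nu p q.
Proof. by rewrite /specmx linearD linearZ /= tr_scalar_mx trmx_mul trmxK. Qed.

(** On at most two eigenvalues every function [f] is affine, so [mxfun f] is an
    affine function of the matrix itself, whatever the diagonalization. *)
Lemma mxfun_specmx (f : R -> R) nu p q : nu != 0 ->
  mxfun f (specmx nu p q) = specmx nu (f p) (f q).
Proof.
move=> nu0; have [P [d [PdA dE]]] := rank1_orthodiag q (p - q) nu0.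
rewrite (mxfun_orthodiag f PdA); case: PdA => PP AE.
(* The slope of the affine function that agrees with [f] at [p] and [q]; it
   is 0 when they coincide, which is then the right value. *)
pose b := (f p - f q) / (p - q).
have fd : diag_mx (map_mx f d) = (f q - b * q)%:M + b *: diag_mx d.
  apply/matrixP => i j; rewrite !mxE; case: (i == j); last first.
    by rewrite !mulr0n mulr0 addr0.
  rewrite !mulr1n /b; have [pq|qp] := eqVneq p q.
    by case: (dE i) => ->; rewrite pq !subrr ?addr0 !mul0r subr0 addr0.
  have pq0 : p - q != 0 by rewrite subr_eq0.
  by case: (dE i) => ->; [ring | rewrite subrKC; field].
rewrite fd mulmxDr mulmxDl mul_mx_scalar -scalemxAl PP scalemx1.
rewrite -scalemxAr -scalemxAl -AE /specmx scalerDr scale_scalar_mx scalerA.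
rewrite addrA -raddfD /= subrK; congr (_ + _ *: _); rewrite mulrA; congr (_ / _).
have [->|qp] := eqVneq p q; first by rewrite !subrr mulr0.
by rewrite /b divfK // subr_eq0.
Qed.

Lemma invmx_specmx nu p q : nu != 0 -> p != 0 -> q != 0 ->
  invmx (specmx nu p q) = specmx nu p^-1 q^-1.
Proof.
move=> nu0 p0 q0.
have E : specmx nu p q *m specmx nu p^-1 q^-1 = 1%:M.
  by rewrite mul_specmx // !divff // /specmx subrr mul0r scale0r addr0.
have [Au _] := mulmx1_unit E.
by rewrite -[RHS](mulKmx Au) E mulmx1.
Qed.

Lemma sqnorm_specmx nu p q x : nu != 0 ->
  sqnorm (specmx nu p q *m x) =
  q ^+ 2 * sqnorm x + (p ^+ 2 - q ^+ 2) / sqnorm nu * ((nu^T *m x) 0 0) ^+ 2.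
Proof.
move=> nu0; have [xT E] : (x^T *m nu) 0 0 = (nu^T *m x) 0 0 /\
    (specmx nu p q *m x)^T *m (specmx nu p q *m x) =
    x^T *m specmx nu (p ^+ 2) (q ^+ 2) *m x.
  split; first by rewrite -[x^T *m nu]trmxK trmx_mul trmxK mxE.
  by rewrite trmx_mul tr_specmx -!mulmxA (mulmxA (specmx nu p q)) mul_specmx.
have := congr1 (fun A : 'M[R]_1 => A 0 0) E.
rewrite sqnorm_mx mxE eqxx mulr1n => ->.
rewrite /specmx mulmxDr mulmxDl mul_mx_scalar -scalemxAl sqnorm_mx.
rewrite -scalemxAr -scalemxAl mulmxA -(mulmxA (x^T *m nu)).
rewrite [x^T *m nu]mx11_scalar xT mul_scalar_mx !mxE eqxx mulr1n.
by rewrite -expr2.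
Qed.

(** The square of the norm is a combination of [p ^+ 2] and [q ^+ 2] whose
    coefficients are the squared norms of the two orthogonal components of [x];
    their nonnegativity is the same formula for the two projections. *)
Lemma sqnorm_specmx_le nu p q m x : nu != 0 -> p ^+ 2 <= m -> q ^+ 2 <= m ->
  sqnorm (specmx nu p q *m x) <= m * sqnorm x.
Proof.
move=> nu0 pm qm; pose w := (sqnorm nu)^-1 * ((nu^T *m x) 0 0) ^+ 2.
have E r s : sqnorm (specmx nu r s *m x) =
    s ^+ 2 * sqnorm x + (r ^+ 2 - s ^+ 2) * w.
  by rewrite sqnorm_specmx // /w; ring.
have w0 : 0 <= w by have := sqnorm_ge0 (specmx nu 1 0 *m x); rewrite E; lra.
have xw : w <= sqnorm x.
  by have := sqnorm_ge0 (specmx nu 0 1 *m x); rewrite E; lra.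
rewrite E; have := ler_wpM2r w0 pm.
have xw0 : 0 <= sqnorm x - w by rewrite subr_ge0.
by have := ler_wpM2r xw0 qm; lra.
Qed.

Lemma csqnormE z : csqnorm z = sqnorm (rpart z) + sqnorm (ipart z).
Proof.
by rewrite /csqnorm big_split /=; congr (_ + _); apply: eq_bigr => i _; rewrite mxE.
Qed.

Lemma csqnorm_ge0 z : 0 <= csqnorm z.
Proof. by rewrite csqnormE addr_ge0 ?sqnorm_ge0. Qed.

Lemma sqnormD_le x y : sqnorm (x + y) <= 2 * sqnorm x + 2 * sqnorm y.
Proof.
rewrite /sqnorm !mulr_sumr -big_split /=; apply: ler_sum => i _; rewrite mxE.
by have := sqr_ge0 (x i 0 - y i 0); nra.
Qed.

Lemma csqnormD_le z w : csqnorm (z + w) <= 2 * csqnorm z + 2 * csqnorm w.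
Proof.
rewrite !csqnormE rpartD ipartD.
by have := sqnormD_le (rpart z) (rpart w); have := sqnormD_le (ipart z) (ipart w); lra.
Qed.

Lemma csqnormN z : csqnorm (- z) = csqnorm z.
Proof.
rewrite /csqnorm; apply: eq_bigr => i _; rewrite mxE.
by case: (z i 0) => a b /=; rewrite !sqrrN.
Qed.

Lemma csqnormZ (t : R) z : csqnorm (t%:C%C *: z) = t ^+ 2 * csqnorm z.
Proof.
rewrite !csqnormE rpartZ ipartZ mulrDr /sqnorm !mulr_sumr.
by congr (_ + _); apply: eq_bigr => i _; rewrite mxE exprMn.
Qed.

Lemma csqnorm_specmx_le nu p q m z : nu != 0 -> p ^+ 2 <= m -> q ^+ 2 <= m ->
  csqnorm (cmx (specmx nu p q) *m z) <= m * csqnorm z.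
Proof.
move=> nu0 pm qm; rewrite !csqnormE rpart_mul ipart_mul mulrDr.
by rewrite lerD ?sqnorm_specmx_le.
Qed.

Lemma csqnorm_specmxD_le nu p q m p' q' m' z w : nu != 0 ->
  p ^+ 2 <= m -> q ^+ 2 <= m -> p' ^+ 2 <= m' -> q' ^+ 2 <= m' ->
  csqnorm (cmx (specmx nu p q) *m z + cmx (specmx nu p' q') *m w) <=
  2 * (m * csqnorm z) + 2 * (m' * csqnorm w).
Proof.
move=> nu0 pm qm pm' qm'; apply: le_trans (csqnormD_le _ _) _.
by rewrite lerD // ler_pM2l // csqnorm_specmx_le.
Qed.

Definition wave_amp (t l : R) : R := sin (t * Num.sqrt l) / Num.sqrt l.

Lemma wave_solution_specmx (M : 'cV[int]_n -> 'M[R]_n) (f g : pdist R n) t k p q :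
  k != 0 -> 0 < p -> 0 < q -> M k = specmx (freq k) (- p) (- q) ->
  wave_solution M f g t k =
    cmx (specmx (freq k) (cos (t * Num.sqrt p)) (cos (t * Num.sqrt q))) *m f k +
    cmx (specmx (freq k) (wave_amp t p) (wave_amp t q)) *m g k.
Proof.
move=> k0 p0 q0 ME; have nu0 : freq k != 0 :> 'cV[R]_n by rewrite freq_eq0.
rewrite /wave_solution (negbTE k0) ME -scaleN1r scale_specmx !mulN1r !opprK.
have rp : Num.sqrt p != 0 by rewrite gt_eqF // sqrtr_gt0.
have rq : Num.sqrt q != 0 by rewrite gt_eqF // sqrtr_gt0.
rewrite /sqrtmx /cosmx /sinmx (mxfun_specmx Num.sqrt p q nu0) scale_specmx.
rewrite (mxfun_specmx (@cos R) _ _ nu0) (mxfun_specmx (@sin R) _ _ nu0).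
by rewrite (invmx_specmx nu0 rp rq) (mul_specmx _ _ _ _ nu0).
Qed.

End SpectralMatrices.

(** * The scalar propagators *)

Section WaveAmplitude.
Context {R : realType}.
Implicit Types (t l x : R).

Lemma sin_sqr_le x : 0 <= x -> sin x ^+ 2 <= x ^+ 2.
Proof.
move=> x0.
have h1 : sin x - x <= sin 0 - 0.
  apply: (@is_derive_le0_le _ (fun x => sin x - x) (fun x => cos x - 1)) => //.
have h2 : - sin x - x <= - sin 0 - 0.
  apply: (@is_derive_le0_le _ (fun x => - sin x - x) (fun x => - cos x - 1)) => //.
by rewrite sin0 in h1 h2; nra.
Qed.

Lemma wave_amp_sqr_le_time t l : 0 <= t -> 0 < l -> wave_amp t l ^+ 2 <= t ^+ 2.
Proof.
move=> t0 l0; have w0 : 0 < Num.sqrt l by rewrite sqrtr_gt0.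
rewrite /wave_amp expr_div_n ler_pdivrMr ?exprn_gt0 // -exprMn.
by apply: sin_sqr_le; rewrite mulr_ge0 // ltW.
Qed.

Lemma wave_amp_sqr_le_inv t l : 0 < l -> wave_amp t l ^+ 2 <= l^-1.
Proof.
move=> l0; rewrite /wave_amp expr_div_n sqr_sqrtr ?(ltW l0) //.
by rewrite -[X in _ <= X]mul1r ler_wpM2r ?invr_ge0 ?(ltW l0) //.
Qed.

Lemma cvg_cos_sqrt {T : Type} {F : set_system T} {FF : Filter F}
    (t : R) (l : T -> R) (l0 : R) : l b @[b --> F] --> l0 ->
  cos (t * Num.sqrt (l b)) @[b --> F] --> cos (t * Num.sqrt l0).
Proof.
move=> ll0; apply: (@continuous_cvg _ _ _ _ _ _ (@cos R)); first exact: continuous_cos.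
by apply: cvgMl_tmp; apply: (@continuous_cvg _ _ _ _ _ _ (@Num.sqrt R)) => //; exact: sqrt_continuous.
Qed.

Lemma cvg_wave_amp {T : Type} {F : set_system T} {FF : Filter F}
    (t : R) (l : T -> R) (l0 : R) : 0 < l0 -> l b @[b --> F] --> l0 ->
  wave_amp t (l b) @[b --> F] --> wave_amp t l0.
Proof.
move=> l0gt ll0.
have sl : Num.sqrt (l b) @[b --> F] --> Num.sqrt l0.
  by apply: (@continuous_cvg _ _ _ _ _ _ (@Num.sqrt R)) => //; exact: sqrt_continuous.
apply: cvgM; last by apply: cvgV => //; rewrite gt_eqF // sqrtr_gt0.
apply: (@continuous_cvg _ _ _ _ _ _ (@sin R)); first exact: continuous_sin.
exact: cvgMl_tmp.
Qed.

End WaveAmplitude.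

(** * Convergence of wave solutions in Sobolev norm *)

Section WaveConvergence.
Context {R : realType} {n : nat}.
Implicit Types (t e C s : R) (k : 'cV[int]_n) (f g : pdist R n)
  (p q : 'cV[int]_n -> R) (M : 'cV[int]_n -> 'M[R]_n).

Local Notation wt k := (1 + sqnorm (freq k)).

(** The propagator of the initial velocity gains [e] derivatives, with constant
    [C]. *)
Definition amp_bounded t e C p : Prop := forall k, k != 0 ->
  0 < p k /\ wave_amp t (p k) ^+ 2 * wt k `^ e <= C.

Definition has_symbols M p q : Prop :=
  forall k, k != 0 -> M k = specmx (freq k) (- p k) (- q k).

Lemma wt_ge1 k : 1 <= wt k :> R.
Proof. by rewrite lerDl sqnorm_ge0. Qed.

(** The cosine loses nothing on [f]; the bound [amp_bounded] trades the weight
    of exponent [e] against the sine propagator on [g]. At frequency 0 the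
    solution is [f 0 + t g 0], whence the condition on [t ^+ 2]. *)
Lemma wave_coef_le t e C s0 s1 s2 f g M p q k :
  t ^+ 2 <= C -> s0 <= s1 -> s0 <= s2 + e -> has_symbols M p q ->
  amp_bounded t e C p -> amp_bounded t e C q ->
  wt k `^ s0 * csqnorm (wave_solution M f g t k) <=
  2 * (wt k `^ s1 * csqnorm (f k)) + 2 * C * (wt k `^ s2 * csqnorm (g k)).
Proof.
move=> tC s01 s02 ME pB qB; have [->|k0] := eqVneq k 0.
  have s00 : sqnorm (freq (0 : 'cV[int]_n)) = 0 :> R.
    by apply/eqP; rewrite sqnorm_eq0 freq_eq0.
  rewrite /wave_solution eqxx s00 addr0 !powR1 !mul1r.
  apply: le_trans (csqnormD_le _ _) _; rewrite csqnormZ lerD2l -mulrA.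
  by rewrite ler_pM2l // ler_wpM2r ?csqnorm_ge0.
have [p0 pC] := pB k k0; have [q0 qC] := qB k k0.
have nu0 : freq k != 0 :> 'cV[R]_n by rewrite freq_eq0.
have w0 : 0 < wt k :> R by apply: lt_le_trans (wt_ge1 k).
have we0 : 0 < wt k `^ e by apply: powR_gt0.
rewrite (wave_solution_specmx f g t k0 p0 q0 (ME k k0)).
have cos1 x : cos x ^+ 2 <= 1 :> R.
  by have := cos2Dsin2 x; have := sqr_ge0 (sin x); lra.
have B := csqnorm_specmxD_le (m := 1) (m' := C / wt k `^ e) (f k) (g k) nu0
  (cos1 _) (cos1 _) (p' := wave_amp t (p k)) (q' := wave_amp t (q k)).
rewrite !ler_pdivlMr // in B.
apply: le_trans (ler_wpM2l (powR_ge0 _ _) (B (t * Num.sqrt (p k)) (t * Num.sqrt (q k)) pC qC)) _.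
have f0 := csqnorm_ge0 (f k); have g0 := csqnorm_ge0 (g k).
have w1 := wt_ge1 k; have C0 : 0 <= C by apply: le_trans tC; exact: sqr_ge0.
rewrite mulrDr lerD //.
  by rewrite mul1r mulrCA ler_pM2l // ler_wpM2r // ler_powR.
have ws : wt k `^ s0 <= wt k `^ s2 * wt k `^ e.
  by rewrite -powRD ?ler_powR // (gt_eqF w0) implybT.
rewrite mulrCA -mulrA ler_pM2l //.
have -> : wt k `^ s0 * (C / wt k `^ e * csqnorm (g k)) =
  C * (wt k `^ s0 / wt k `^ e * csqnorm (g k)) by ring.
by rewrite ler_wpM2l // ler_wpM2r // ler_pdivrMr.
Qed.

Lemma esum_lin_lty (I : choiceType) (a b : R) (u v : I -> R) :
  0 <= a -> 0 <= b -> (forall i, 0 <= u i) -> (forall i, 0 <= v i) ->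
  (\esum_(i in [set: I]) (u i)%:E < +oo)%E ->
  (\esum_(i in [set: I]) (v i)%:E < +oo)%E ->
  (\esum_(i in [set: I]) (a * u i + b * v i)%:E < +oo)%E.
Proof.
move=> a0 b0 u0 v0 us vs.
have fin (w : I -> R) (X : set I) : (forall i, 0 <= w i) -> finite_set X ->
    (\esum_(i in [set: I]) (w i)%:E < +oo)%E ->
    \sum_(i \in X) w i <= fine (\esum_(i in [set: I]) (w i)%:E).
  move=> w0 Xf ws; rewrite -lee_fin fineK; last first.
    by rewrite ge0_fin_numE // esum_ge0 // => i _; rewrite lee_fin.
  by apply: esum_ge; exists X; rewrite ?fsumEFin.
apply: le_lt_trans (ltry (a * fine (\esum_(i in [set: I]) (u i)%:E) +
  b * fine (\esum_(i in [set: I]) (v i)%:E))).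
apply: ge_ereal_sup => _ [X [Xf _] <-]; rewrite fsumEFin // lee_fin.
have -> : \sum_(i \in X) (a * u i + b * v i) =
    a * (\sum_(i \in X) u i) + b * (\sum_(i \in X) v i).
  by rewrite !fsbig_finite // big_split /= -!mulr_sumr.
by rewrite lerD // ler_wpM2l // fin.
Qed.

Lemma cvg_sqr_dist (T : Type) (F : set_system T) {FF : Filter F}
    (x y : T -> R) (x0 y0 : R) :
  x b @[b --> F] --> x0 -> y b @[b --> F] --> y0 ->
  (x b - x0) ^+ 2 + (y b - y0) ^+ 2 @[b --> F] --> (0 : R).
Proof.
move=> xx0 yy0.
have sq (z : T -> R) (z0 : R) : z b @[b --> F] --> z0 ->
    (z b - z0) ^+ 2 @[b --> F] --> (0 : R).
  move=> zz0; have d0 : z b - z0 @[b --> F] --> (0 : R).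
    by rewrite -(subrr z0); apply: cvgB => //; exact: cvg_cst.
  by under eq_fun do rewrite expr2; rewrite -(mulr0 (0 : R)); exact: cvgM.
by rewrite -[0 : R]addr0; apply: cvgD; exact: sq.
Qed.

(** Dominated convergence: all solutions obey the bound of [wave_coef_le], and
    on each frequency the propagators depend continuously on the symbols. *)
Theorem wave_solution_cvg (T : Type) (F : set_system T) {FF : Filter F}
    t e C s0 s1 s2 f g (M : T -> 'cV[int]_n -> 'M[R]_n) M0
    (p q : T -> 'cV[int]_n -> R) p0 q0 :
  t ^+ 2 <= C -> s0 <= s1 -> s0 <= s2 + e ->
  sobolev s1 f -> sobolev s2 g ->
  (forall b, has_symbols (M b) (p b) (q b)) -> has_symbols M0 p0 q0 ->
  (\forall b \near F, amp_bounded t e C (p b)) ->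
  (\forall b \near F, amp_bounded t e C (q b)) ->
  amp_bounded t e C p0 -> amp_bounded t e C q0 ->
  (forall k, p b k @[b --> F] --> p0 k) ->
  (forall k, q b k @[b --> F] --> q0 k) ->
  [/\ \forall b \near F, sobolev s0 (wave_solution (M b) f g t),
      sobolev s0 (wave_solution M0 f g t) &
      sobolev_norm s0 (wave_solution (M b) f g t \- wave_solution M0 f g t)
        @[b --> F] --> 0%E].
Proof.
move=> tC s01 s02 fS gS ME M0E pB qB p0B q0B pp0 qq0.
have C0 : 0 <= C by apply: le_trans tC; exact: sqr_ge0.
pose A k := wt k `^ s1 * csqnorm (f k); pose B k := wt k `^ s2 * csqnorm (g k).
have A0 k : 0 <= A k by rewrite mulr_ge0 ?powR_ge0 ?csqnorm_ge0.
have B0 k : 0 <= B k by rewrite mulr_ge0 ?powR_ge0 ?csqnorm_ge0.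
have bound b k : amp_bounded t e C (p b) -> amp_bounded t e C (q b) ->
    wt k `^ s0 * csqnorm (wave_solution (M b) f g t k) <=
    2 * A k + 2 * C * B k.
  by move=> pb qb; exact: wave_coef_le (ME b) pb qb.
have bound0 k : wt k `^ s0 * csqnorm (wave_solution M0 f g t k) <=
    2 * A k + 2 * C * B k by exact: wave_coef_le M0E p0B q0B.
have fin a b : 0 <= a -> 0 <= b ->
    (\esum_(k in [set: 'cV[int]_n]) (a * A k + b * B k)%:E < +oo)%E.
  by move=> a0 b0; apply: esum_lin_lty.
have fin2 : (\esum_(k in [set: 'cV[int]_n]) (2 * A k + 2 * C * B k)%:E < +oo)%E.
  by apply: fin; rewrite ?mulr_ge0.
split.
- near=> b; apply: le_lt_trans fin2; apply: le_esum => k _; rewrite lee_fin.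
  by apply: bound; near: b.
- by apply: le_lt_trans fin2; apply: le_esum => k _; rewrite lee_fin.
set U := fun b => wave_solution (M b) f g t; set V := wave_solution M0 f g t.
pose u b k := wt k `^ s0 * csqnorm (U b k - V k).
have u0 k : u b k @[b --> F] --> (0 : R).
  rewrite -(mulr0 (wt k `^ s0)); apply: cvgMl_tmp.
  have [->|k0] := eqVneq k 0.
    rewrite /U /V /wave_solution eqxx subrr.
    have -> : csqnorm (0 : 'cV[R[i]]_n) = 0.
      by rewrite -(mul0mx _ (0 : 'cV[R[i]]_n)) /csqnorm big1 // => i _;
        rewrite !mxE big1 ?expr0n ?addr0 // => j _; rewrite mxE mul0r.
    exact: cvg_cst.
  have nu0 : freq k != 0 :> 'cV[R]_n by rewrite freq_eq0.
  have [p0k _] := p0B k k0; have [q0k _] := q0B k k0.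
  have cs := cvg_sqr_dist (cvg_cos_sqrt (t := t) (pp0 k))
    (cvg_cos_sqrt (t := t) (qq0 k)).
  have sn := cvg_sqr_dist (cvg_wave_amp (t := t) p0k (pp0 k))
    (cvg_wave_amp (t := t) q0k (qq0 k)).
  set c2 := fun b : T => _ in cs; set a2 := fun b : T => _ in sn.
  have h0 : 2 * (c2 b * csqnorm (f k)) + 2 * (a2 b * csqnorm (g k)) @[b --> F]
      --> (0 : R).
    have -> : (0 : R) = 2 * (0 * csqnorm (f k)) + 2 * (0 * csqnorm (g k)) by ring.
    by apply: cvgD; apply: cvgMl_tmp; apply: cvgMr_tmp; [exact: cs | exact: sn].
  apply: (squeeze_cvgr _ (cvg_cst 0) h0); near=> b; rewrite csqnorm_ge0 /=.
  have pbB : amp_bounded t e C (p b) by near: b.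
  have qbB : amp_bounded t e C (q b) by near: b.
  have [pb _] := pbB k k0; have [qb _] := qbB k k0.
  rewrite /U /V (wave_solution_specmx f g t k0 pb qb (ME b k k0)).
  rewrite (wave_solution_specmx f g t k0 p0k q0k (M0E k k0)).
  rewrite opprD addrACA -!mulmxBl -!raddfB /= !specmxB.
  by apply: csqnorm_specmxD_le => //; rewrite /c2 /a2 ?lerDl ?lerDr sqr_ge0.
have uD : \forall b \near F, forall k, 0 <= u b k <= 8 * A k + 8 * C * B k.
  near=> b => k; rewrite /u mulr_ge0 ?powR_ge0 ?csqnorm_ge0 //=.
  have bb : wt k `^ s0 * csqnorm (U b k) <= 2 * A k + 2 * C * B k.
    by apply: bound; near: b.
  apply: (@le_trans _ _ (wt k `^ s0 * (2 * csqnorm (U b k) + 2 * csqnorm (V k)))).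
    apply: ler_wpM2l; first exact: powR_ge0.
    by rewrite -(csqnormN (V k)); exact: csqnormD_le.
  have arith (w x y a b' : R) : w * x <= 2 * a + 2 * C * b' ->
      w * y <= 2 * a + 2 * C * b' -> w * (2 * x + 2 * y) <= 8 * a + 8 * C * b'.
    by lra.
  exact: arith bb (bound0 k).
have C80 : 0 <= 8 * C by rewrite mulr_ge0.
have D0 k : 0 <= 8 * A k + 8 * C * B k.
  by apply: addr_ge0; apply: mulr_ge0; rewrite ?A0 ?B0.
have norm_small : forall r : R, 0 < r ->
    \forall b \near F, (sobolev_norm s0 (U b \- V)%R <= r%:E)%E.
  move=> r r0; have r20 : 0 < r ^+ 2 by rewrite exprn_gt0.
  have sm : \forall b \near F,
      (\esum_(k in [set: 'cV[int]_n]) (u b k)%:E <= (r ^+ 2)%:E)%E.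
    by apply: (esum_dominated_cvg0 uD) => //; exact: fin.
  apply: filterS sm => b ub; rewrite -[r%:E]gee0_abs ?lee_fin ?(ltW r0) //.
  by rewrite -sqrte_sqr lee_sqrt // lee_fin sqr_ge0.
have norm_ge0 b : (0 <= sobolev_norm s0 (U b \- V)%R)%E by exact: sqrte_ge0.
have norm_fin b r : (sobolev_norm s0 (U b \- V)%R <= r%:E)%E ->
    sobolev_norm s0 (U b \- V)%R \is a fin_num.
  by move=> le; rewrite ge0_fin_numE // (le_lt_trans le) ?ltry.
apply/fine_cvgP; split.
  near=> b; apply: (@norm_fin b 1); near: b; exact: norm_small.
apply/cvgrPdist_le => r r0; near=> b.
have le : (sobolev_norm s0 (U b \- V)%R <= r%:E)%E by near: b; exact: norm_small.
rewrite sub0r normrN ger0_norm ?(fine_ge0 (norm_ge0 b)) //.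
by rewrite -lee_fin fineK // (norm_fin b r).
Unshelve. all: by end_near. Qed.

End WaveConvergence.

(** * The two peridynamic symbols as [a] tends to 0 *)

Section LamSymbols.
Context {R : realType}.
Implicit Types (a c y lam mu : R).

(** The eigenvalues of the peridynamic matrix divided by [- |nu| ^+ 2]. *)
Definition longitudinal c lam mu a y : R :=
  3 * mu * ((1 - 2 / 3 * a) * psum (avg a (bessel_mean c)) y +
            2 / 3 * a * psum (bessel_mean c) y) +
  (lam - mu) * psum (avg a (bessel c)) y ^+ 2.

Definition transverse c mu a y : R := mu * psum (avg a (bessel_mean c)) y.

Lemma cvg_right0 : a @[a --> (0 : R)^'+] --> (0 : R).
Proof. by apply: cvg_at_right_filter; exact: cvg_id. Qed.

Lemma psum_avg_cvg (d : nat -> R) y : fact_bounded d ->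
  psum (avg a d) y @[a --> (0 : R)^'+] --> d 0%N.
Proof.
move=> dB; have aK : a * expR `|y| @[a --> (0 : R)^'+] --> (0 : R).
  by rewrite -[0 in X in _ --> X](mul0r (expR `|y|)); apply: cvgMr_tmp; exact: cvg_right0.
have low : d 0%N - a * expR `|y| @[a --> (0 : R)^'+] --> d 0%N.
  by rewrite -[X in _ --> X]subr0; apply: cvgB aK; exact: cvg_cst.
have upp : d 0%N + a * expR `|y| @[a --> (0 : R)^'+] --> d 0%N.
  by rewrite -[X in _ --> X]addr0; apply: cvgD aK; exact: cvg_cst.
apply: (squeeze_cvgr _ low upp); near=> a.
by rewrite -ler_distl; apply: psum_avg_near.
Unshelve. all: by end_near. Qed.

Lemma transverse_cvg c mu y : 1 <= c ->
  transverse c mu a y @[a --> (0 : R)^'+] --> mu.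
Proof.
move=> c1; rewrite -[X in _ --> X]mulr1 -(bessel_mean0 c); apply: cvgMl_tmp.
by apply: psum_avg_cvg; exact: fact_bounded_bessel_mean.
Qed.

Lemma longitudinal_cvg c lam mu y : 1 <= c ->
  longitudinal c lam mu a y @[a --> (0 : R)^'+] --> lam + 2 * mu.
Proof.
move=> c1; have mB := fact_bounded_bessel_mean c1; have bB := fact_bounded_bessel c1.
have -> : lam + 2 * mu = 3 * mu * ((1 - 2 / 3 * 0) * bessel_mean c 0 +
    2 / 3 * 0 * psum (bessel_mean c) y) + (lam - mu) * (bessel c 0 * bessel c 0).
  by rewrite bessel0 bessel_mean0; ring.
have a0 : 2 / 3 * a @[a --> (0 : R)^'+] --> (2 / 3 * 0 : R).
  by apply: cvgMl_tmp; exact: cvg_right0.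
apply: cvgD; last first.
  apply: cvgMl_tmp; under eq_fun do rewrite expr2.
  by apply: cvgM; exact: psum_avg_cvg.
apply: cvgMl_tmp; apply: cvgD; last exact: cvgMr_tmp.
by apply: cvgM; [apply: cvgB => //; exact: cvg_cst | exact: psum_avg_cvg].
Qed.

Lemma transverse_lower c mu : 0 < mu -> 1 <= c ->
  exists2 c0, 0 < c0 & \forall a \near (0 : R)^'+,
    forall y, 1 <= y -> c0 <= y `^ a * transverse c mu a y.
Proof.
move=> mu0 c1; exists (mu / 2); first by rewrite divr_gt0.
have mB := fact_bounded_bessel_mean c1.
have lim : transverse c mu a 1 @[a --> (0 : R)^'+] --> mu.
  exact: transverse_cvg.
have m2 : mu / 2 < mu by lra.
near=> a => y y1; have a0 : 0 < a by [].
have half : mu / 2 < transverse c mu a 1 by near: a; exact: (cvgr_gt _ lim).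
apply: le_trans (ltW half) _; rewrite /transverse mulrCA ler_pM2l //.
exact: powR_mean_nondecr.
Unshelve. all: by end_near. Qed.

(** Only a negative [lam - mu] can hurt. The worst case [kappa = mu - lam] leaves
    [3 * mu - kappa = lam + 2 * mu] in the limit, and half of the limit remains
    for small [a]. *)
Lemma longitudinal_lower c lam mu : 0 < mu -> 0 < lam + 2 * mu -> 3 / 2 <= c ->
  exists2 c0, 0 < c0 & \forall a \near (0 : R)^'+,
    forall y, 1 <= y -> c0 <= y `^ a * longitudinal c lam mu a y.
Proof.
move=> mu0 lm0 c32; have c1 : 1 <= c by lra.
pose kappa := Num.max 0 (mu - lam).
have k0 : 0 <= kappa by rewrite le_max lexx.
have kl : mu - lam <= kappa by rewrite le_max lexx orbT.
have k3 : kappa < 3 * mu by rewrite gt_max; apply/andP; split; lra.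
have mB := fact_bounded_bessel_mean c1; have bB := fact_bounded_bessel c1.
pose low a := 3 * mu * ((1 - 2 / 3 * a) * psum (avg a (bessel_mean c)) 1) -
  kappa * (psum (avg a (bessel c)) 1 * psum (avg a (bessel c)) 1 + a * (2 * c)).
have lim : low a @[a --> (0 : R)^'+] --> 3 * mu - kappa.
  have -> : 3 * mu - kappa = 3 * mu * ((1 - 2 / 3 * 0) * bessel_mean c 0) -
    kappa * (bessel c 0 * bessel c 0 + 0 * (2 * c)).
    by rewrite bessel0 bessel_mean0; ring.
  have a0 : 2 / 3 * a @[a --> (0 : R)^'+] --> (2 / 3 * 0 : R).
    by apply: cvgMl_tmp; exact: cvg_right0.
  apply: cvgB; apply: cvgMl_tmp.
    by apply: cvgM; [apply: cvgB => //; exact: cvg_cst | exact: psum_avg_cvg].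
  apply: cvgD; first by apply: cvgM; exact: psum_avg_cvg.
  by apply: cvgMr_tmp; exact: cvg_right0.
exists ((3 * mu - kappa) / 2); first by rewrite divr_gt0 // subr_gt0.
have m2 : (3 * mu - kappa) / 2 < 3 * mu - kappa by lra.
near=> a => y y1; have a0 : 0 < a by [].
have a2 : a <= 1 / 2 by near: a; apply: nbhs_right_le; lra.
have half : (3 * mu - kappa) / 2 < low a by near: a; exact: (cvgr_gt _ lim).
apply: le_trans (ltW half) _.
have y0 : 0 < y by lra.
have G0 := bessel_mean_ge0 c1 y0.
have H1 := powR_mean_nondecr a0 c1 y1.
have a1 : a < 1 by lra.
have B1 := powR_bessel_avg_le a0 a1 c32 y1.
have ya : 0 <= y `^ a := powR_ge0 _ _.
have ac : a * c / (1 - a) <= a * (2 * c).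
  rewrite -mulrA ler_pM2l // ler_pdivrMr; last by lra.
  nra.
rewrite /low /longitudinal; move: G0 H1 B1 ac ya.
move: (psum (bessel_mean c) y) (psum (avg a (bessel_mean c)) 1)
  (psum (avg a (bessel_mean c)) y) (psum (avg a (bessel c)) 1)
  (psum (avg a (bessel c)) y) (a * c / (1 - a)) (y `^ a).
move=> G h1 h b1 b r w G0 H1 B1 ac w0.
have E1 : (1 - 2 / 3 * a) * h1 <=
    w * ((1 - 2 / 3 * a) * h + 2 / 3 * a * G).
  have s1 : (1 - 2 / 3 * a) * h1 <= (1 - 2 / 3 * a) * (w * h).
    by rewrite ler_pM2l //; lra.
  have s2 : 0 <= 2 / 3 * (a * (w * G)) by rewrite !mulr_ge0 // ltW.
  by lra.
have E2 : - (kappa * (b1 * b1 + a * (2 * c))) <= w * ((lam - mu) * b ^+ 2).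
  have wb : 0 <= w * b ^+ 2 by rewrite mulr_ge0 ?sqr_ge0.
  have t1 : (mu - lam) * (w * b ^+ 2) <= kappa * (w * b ^+ 2) by rewrite ler_wpM2r.
  have t2 : kappa * (w * b ^+ 2) <= kappa * (b1 * b1 + a * (2 * c)).
    by rewrite ler_wpM2l // -expr2; lra.
  by lra.
have E3 : 3 * mu * ((1 - 2 / 3 * a) * h1) <=
    3 * mu * (w * ((1 - 2 / 3 * a) * h + 2 / 3 * a * G)).
  by rewrite ler_wpM2l //; lra.
by lra.
Unshelve. all: by end_near. Qed.

Lemma powR_growth (e a c0 x y : R) : 0 < c0 -> a <= 1 - e -> 1 <= y ->
  c0 <= y `^ a * x -> c0 * y `^ e <= y * x.
Proof.
move=> c00 ae y1 c0x; have y0 : 0 < y by lra.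
have -> : y * x = y `^ a * x * y `^ (1 - a).
  rewrite mulrAC -powRD; last by rewrite (gt_eqF y0) implybT.
  by rewrite subrKC powRr1 // ltW.
apply: ler_pM; rewrite ?powR_ge0 ?(ltW c00) // ler_powR //; lra.
Qed.

End LamSymbols.

(** * Peridynamic and Navier multipliers *)

Section MultiplierGrowth.
Context {R : realType} {n : nat}.
Variable delta : R.
Hypothesis delta_gt0 : 0 < delta.
Implicit Types (beta lam mu t e : R) (nu : 'cV[R]_n) (k : 'cV[int]_n).

Local Notation c := (n%:R / 2 + 1 : R).
Local Notation arg nu := (4^-1 * sqnorm nu * delta ^+ 2).
Local Notation decay beta := ((n%:R + 2 - beta) / 2).

Lemma lambda1E lam mu beta nu : beta < n%:R + 2 ->
  lambda1 delta lam mu beta nu =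
  - (sqnorm nu * longitudinal c lam mu (decay beta) (arg nu)).
Proof.
move=> bn; have a0 : 0 < decay beta by lra.
have n0 : 0 <= n%:R :> R by [].
have c1 : 1 <= c by lra.
have c0 : 0 < c by lra.
rewrite /lambda1 /longitudinal -hypergeom34 // -hypergeom12 //.
have -> : (n%:R + 4) / 2 = c + 1 by field.
have -> : (n%:R + 4 - beta) / 2 = decay beta + 1 by field.
have -> : (n%:R + 2) / 2 = c by field.
by rewrite mulNr.
Qed.

Lemma lambda2E mu beta nu : beta < n%:R + 2 ->
  lambda2 delta mu beta nu =
  - (sqnorm nu * transverse c mu (decay beta) (arg nu)).
Proof.
move=> bn; have a0 : 0 < decay beta by lra.
have n0 : 0 <= n%:R :> R by [].
have c0 : 0 < c by lra.
rewrite /lambda2 /transverse -hypergeom23 //.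
have -> : (n%:R + 4) / 2 = c + 1 by field.
have -> : (n%:R + 4 - beta) / 2 = decay beta + 1 by field.
by ring.
Qed.

Lemma naviermxE lam mu nu : nu != 0 -> naviermx lam mu nu =
  specmx nu (- (sqnorm nu * (lam + 2 * mu))) (- (sqnorm nu * mu)).
Proof.
move=> nu0; have N0 : sqnorm nu != 0 by rewrite sqnorm_eq0.
rewrite /naviermx /specmx addrC -scaleNr -raddfN; congr (_%:M + _ *: _).
  by rewrite mulrC.
by field.
Qed.

Lemma cvg_decay : decay beta @[beta --> (n%:R + 2 : R)^'-] --> (0 : R)^'+.
Proof.
move=> P [r /= r0 rP].
suff : \forall beta \near (n%:R + 2 : R)^'-, P (decay beta) by [].
near=> beta; apply: rP => /=; last first.
  by rewrite divr_gt0 // subr_gt0.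
have lt : n%:R + 2 - r < beta.
  by near: beta; apply: nbhs_left_gt; rewrite ltrBlDr ltrDl.
have lt2 : beta < n%:R + 2 by [].
rewrite sub0r normrN ger0_norm; last by rewrite divr_ge0 // subr_ge0 ltW.
by rewrite ltr_pdivrMr //; lra.
Unshelve. all: by end_near. Qed.

(** At high frequency the sine propagator is at most the inverse square root of
    the symbol, which the growth condition controls; at low frequency the weight
    is bounded and the propagator is at most [t]. *)
Lemma growth_amp_bounded t e c1 (p : 'cV[int]_n -> R) :
  0 <= t -> 0 <= e <= 1 -> 0 < c1 ->
  (forall k, k != 0 -> 0 < p k) ->
  (forall k, 1 <= arg (freq k) -> c1 * arg (freq k) `^ e <= p k) ->
  amp_bounded t e ((1 + 4 / delta ^+ 2) * (t ^+ 2 + c1^-1)) p.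
Proof.
move=> t0 /andP[e0 e1] c10 p0 pc k k0; split; first exact: p0.
have d0 : 0 < delta ^+ 2 by rewrite exprn_gt0.
set W := 1 + 4 / delta ^+ 2; set y := arg (freq k).
have W1 : 1 <= W by rewrite lerDl divr_ge0 // ltW.
have W0 : 0 < W by lra.
have s0 : 0 <= sqnorm (freq k : 'cV[R]_n) := sqnorm_ge0 _.
have sE : sqnorm (freq k) = 4 / delta ^+ 2 * y.
  by rewrite /y; field; rewrite gt_eqF.
have We : W `^ e <= W by rewrite -[leRHS](powRr1 (ltW W0)) ler_powR.
have pk := p0 k k0.
have at2 := wave_amp_sqr_le_time t0 pk.
have ainv := wave_amp_sqr_le_inv t pk.
have ci : 0 < c1^-1 by rewrite invr_gt0.
have A0 : 0 <= wave_amp t (p k) ^+ 2 := sqr_ge0 _.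
have t20 : 0 <= t ^+ 2 := sqr_ge0 _.
have w0 : 0 <= 1 + sqnorm (freq k) :> R by lra.
have [y1|y1] := lerP 1 y.
  have pw : 0 < y `^ e by apply: powR_gt0; lra.
  have step : (1 + sqnorm (freq k)) `^ e <= W * y `^ e.
    have sW : 1 + sqnorm (freq k) <= W * y by rewrite sE /W; lra.
    have Wy0 : 0 <= W * y by apply: le_trans sW.
    apply: (@le_trans _ _ ((W * y) `^ e)); first exact: ge0_ler_powR.
    have y0 : 0 <= y by lra.
    by rewrite powRM ?(ltW W0) // ler_pM2r.
  apply: le_trans (ler_wpM2l A0 step) _.
  have key : wave_amp t (p k) ^+ 2 * y `^ e <= c1^-1.
    apply: le_trans (ler_wpM2r (ltW pw) ainv) _.
    rewrite mulrC ler_pdivrMr // mulrC ler_pdivlMr // mulrC.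
    exact: pc.
  have : W * (wave_amp t (p k) ^+ 2 * y `^ e) <= W * c1^-1.
    by rewrite ler_pM2l.
  have : 0 <= W * t ^+ 2 by rewrite mulr_ge0 // ltW.
  by lra.
have step : (1 + sqnorm (freq k)) `^ e <= W.
  apply: le_trans We; rewrite ge0_ler_powR ?nnegrE ?(ltW W0) //.
  by rewrite sE /W lerD2l ler_piMr ?divr_ge0 // ltW.
have : wave_amp t (p k) ^+ 2 * (1 + sqnorm (freq k)) `^ e <= t ^+ 2 * W.
  by apply: ler_pM => //; exact: powR_ge0.
have : 0 <= W * c1^-1 by rewrite mulr_ge0 // ltW.
by lra.
Qed.

End MultiplierGrowth.

(** * The limit of the peridynamic solutions *)

Theorem theorem20 (R : realType) (n : nat) (n_ge1 : (1 <= n)%N)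
    (delta lam mu : R) (delta_gt0 : 0 < delta)
    (mu_gt0 : 0 < mu) (lam2mu_gt0 : 0 < lam + 2 * mu)
    (lambda1_lt0 : forall (beta : R) (nu : 'cV[R]_n),
       beta < n%:R + 2 -> nu != 0 -> lambda1 delta lam mu beta nu < 0)
    (lambda2_lt0 : forall (beta : R) (nu : 'cV[R]_n),
       beta < n%:R + 2 -> nu != 0 -> lambda2 delta mu beta nu < 0)
    (s1 s2 : R) (f g : pdist R n)
    (f_sobolev : sobolev s1 f) (g_sobolev : sobolev s2 g) :
  forall (t eps : R), 0 <= t -> 0 < eps -> eps < 2 ->
    sobolev_cvg (Num.min s1 (s2 + (2 - eps) / 2))
      ((n%:R + 2 : R)^'-)
      (fun beta : R => peridynamic_solution delta lam mu beta f g t)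
      (navier_solution lam mu f g t).
Proof.
move=> t eps t0 eps0 eps2.
set c : R := n%:R / 2 + 1.
have c32 : 3 / 2 <= c.
  by have : 1 <= n%:R :> R; [rewrite ler1n | rewrite /c; lra].
have c1 : 1 <= c by lra.
have [cl cl0 lowl] := longitudinal_lower mu_gt0 lam2mu_gt0 c32.
have [ct ct0 lowt] := transverse_lower mu_gt0 c1.
(* One constant below the growth constants of all four symbols. *)
pose c0 := Num.min (Num.min cl ct) (Num.min (lam + 2 * mu) mu).
have c00 : 0 < c0 by rewrite !lt_min cl0 ct0 lam2mu_gt0 mu_gt0.
have c0l : c0 <= cl by rewrite !ge_min lexx.
have c0t : c0 <= ct by rewrite !ge_min lexx orbT.
have c0lm : c0 <= lam + 2 * mu by rewrite !ge_min lexx !orbT.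
have c0m : c0 <= mu by rewrite !ge_min lexx !orbT.
pose K := 4 / delta ^+ 2.
have d20 : 0 < delta ^+ 2 by rewrite exprn_gt0.
have K0 : 0 < K by rewrite divr_gt0.
pose y (k : 'cV[int]_n) : R := 4^-1 * sqnorm (freq k) * delta ^+ 2.
have sE k : sqnorm (freq k) = K * y k.
  by rewrite /K /y; field; rewrite gt_eqF.
have s_gt0 (k : 'cV[int]_n) : k != 0 -> 0 < sqnorm (freq k) :> R.
  by move=> k0; rewrite lt_def sqnorm_eq0 freq_eq0 k0 sqnorm_ge0.
pose e : R := 1 - eps / 2.
have e01 : 0 <= e <= 1 by apply/andP; split; rewrite /e; lra.
pose c2 := K * c0; have c20 : 0 < c2 by rewrite mulr_gt0.
pose C := (1 + 4 / delta ^+ 2) * (t ^+ 2 + c2^-1).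
have amp (p sym : 'cV[int]_n -> R) a : 0 <= a -> a <= 1 - e ->
    (forall k, p k = sqnorm (freq k) * sym k) ->
    (forall k, k != 0 -> 0 < p k) ->
    (forall k, 1 <= y k -> c0 <= y k `^ a * sym k) -> amp_bounded t e C p.
  move=> a0 ae pE p0 low; apply: growth_amp_bounded => // k yk.
  rewrite -/(y k) pE sE /c2 -[K * c0 * _]mulrA -[K * y k * _]mulrA ler_pM2l //.
  exact: powR_growth c00 ae yk (low k yk).
pose p beta (k : 'cV[int]_n) := - lambda1 delta lam mu beta (freq k).
pose q beta (k : 'cV[int]_n) := - lambda2 delta mu beta (freq k).
pose p0 (k : 'cV[int]_n) := sqnorm (freq k) * (lam + 2 * mu).
pose q0 (k : 'cV[int]_n) := sqnorm (freq k) * mu.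
have near_decay (P : R -> Prop) : (\forall a \near (0 : R)^'+, P a) ->
    \forall beta \near (n%:R + 2 : R)^'-, P ((n%:R + 2 - beta) / 2).
  by move=> /(@cvg_decay R n).
have a_small : \forall a \near (0 : R)^'+, a <= 1 - e.
  by apply: nbhs_right_le; rewrite /e; lra.
have pE beta k : beta < n%:R + 2 -> p beta k =
    sqnorm (freq k) * longitudinal c lam mu ((n%:R + 2 - beta) / 2) (y k).
  by move=> b; rewrite /p lambda1E // opprK.
have qE beta k : beta < n%:R + 2 -> q beta k =
    sqnorm (freq k) * transverse c mu ((n%:R + 2 - beta) / 2) (y k).
  by move=> b; rewrite /q lambda2E // opprK.
apply: (@wave_solution_cvg _ _ _ _ _ t e C _ s1 s2 f g _ _ p q p0 q0) => //.
- rewrite /C; have : 0 < c2^-1 by rewrite invr_gt0.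
  have : 0 <= 4 / delta ^+ 2 * (t ^+ 2 + c2^-1).
    by rewrite mulr_ge0 ?(ltW K0) // addr_ge0 ?sqr_ge0 // invr_ge0 ltW.
  lra.
- by rewrite ge_min lexx.
- have -> : s2 + e = s2 + (2 - eps) / 2 by rewrite /e; field.
  by rewrite ge_min lexx orbT.
- by move=> beta k k0; rewrite /p /q !opprK.
- by move=> k k0; apply: naviermxE; rewrite freq_eq0.
- near=> beta; have b2 : beta < n%:R + 2 by [].
  apply: (amp _ _ ((n%:R + 2 - beta) / 2)) (fun k => pE beta k b2) _ _.
  + by rewrite divr_ge0 // subr_ge0 ltW.
  + by near: beta; exact: (near_decay (fun a => a <= 1 - e)).
  + by move=> k k0; rewrite oppr_gt0; apply: lambda1_lt0; rewrite ?freq_eq0.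
  + move=> k yk; apply: le_trans c0l _; move: (y k) yk.
    by near: beta; exact: (near_decay (fun a => forall z, 1 <= z ->
      cl <= z `^ a * longitudinal c lam mu a z)).
- near=> beta; have b2 : beta < n%:R + 2 by [].
  apply: (amp _ _ ((n%:R + 2 - beta) / 2)) (fun k => qE beta k b2) _ _.
  + by rewrite divr_ge0 // subr_ge0 ltW.
  + by near: beta; exact: (near_decay (fun a => a <= 1 - e)).
  + by move=> k k0; rewrite oppr_gt0; apply: lambda2_lt0; rewrite ?freq_eq0.
  + move=> k yk; apply: le_trans c0t _; move: (y k) yk.
    by near: beta; exact: (near_decay (fun a => forall z, 1 <= z ->
      ct <= z `^ a * transverse c mu a z)).
- apply: (amp _ (fun=> lam + 2 * mu) 0) => // [||k yk].
  + by rewrite /e; lra.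
  + by move=> k k0; rewrite mulr_gt0 ?s_gt0.
  + by rewrite powRr0 mul1r.
- apply: (amp _ (fun=> mu) 0) => // [||k yk].
  + by rewrite /e; lra.
  + by move=> k k0; rewrite mulr_gt0 ?s_gt0.
  + by rewrite powRr0 mul1r.
- move=> k.
  have lim : sqnorm (freq k) * longitudinal c lam mu ((n%:R + 2 - beta) / 2) (y k)
      @[beta --> (n%:R + 2 : R)^'-] --> p0 k.
    have sym_cvg : longitudinal c lam mu a (y k) @[a --> (0 : R)^'+] --> lam + 2 * mu.
      exact: longitudinal_cvg.
    by apply: cvgMl_tmp; exact: (cvg_comp _ _ (@cvg_decay R n) sym_cvg).
  apply: cvg_trans lim; apply: near_eq_cvg; near=> beta.
  by rewrite pE.
- move=> k.
  have lim : sqnorm (freq k) * transverse c mu ((n%:R + 2 - beta) / 2) (y k)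
      @[beta --> (n%:R + 2 : R)^'-] --> q0 k.
    have sym_cvg : transverse c mu a (y k) @[a --> (0 : R)^'+] --> mu.
      exact: transverse_cvg.
    by apply: cvgMl_tmp; exact: (cvg_comp _ _ (@cvg_decay R n) sym_cvg).
  apply: cvg_trans lim; apply: near_eq_cvg; near=> beta.
  by rewrite qE.
Unshelve. all: by end_near. Qed.
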